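(* Let $n\ge 1$ and $k$ be integers with $0\le k\le n+1$. The triple $$\bigl(\mathrm{NCC}(n+1,k),\ \langle\mathrm{rot}_n\rangle,\ \mathbf{Nar}(n+1,k;q)\bigr)$$ exhibits the cyclic sieving phenomenon, where $\langle\mathrm{rot}_n\rangle$ is regarded as an action of the cyclic group of order $n$.
   Context: Cyclic sieving: let $X$ be a finite set, $C_N$ a cyclic group of order $N$ with generator $g$ acting on $X$, and $f(q)$ a polynomial with non-negative integer coefficients. The triple $(X,C_N,f(q))$ exhibits the cyclic sieving phenomenon if for all $d\in\mathbb Z$, $|\{x\in X: g^d\cdot x=x\}|=f(\xi^d)$, where $\xi$ is a primitive $N$-th complex root of unity. $[m]_q=1+q+\dots+q^{m-1}$; $\begin{bmatrix} m\\ r\end{bmatrix}_q$ is the Gaussian $q$-binomial coefficient, equal to $0$ unless $m\ge r\ge 0$. The $q$-Narayana polynomial is $\mathbf{Nar}(m,k;q)=\frac{q^{k(k-1)}}{[m]_q}\begin{bmatrix} m\\ k\end{bmatrix}_q\begin{bmatrix} m\\ k-1\end{bmatrix}_q$. A non-crossing $(1,2)$-configuration on $n$ vertices: place vertices $1,\dots,n$ around a circle; a configuration consists of a set of pairwise non-intersecting proper edges (chords joining two distinct vertices, pairwise non-crossing and not sharing endpoints) together with a set of loops, each loop placed on a vertex not incident to a proper edge (at most one loop per vertex). $\mathrm{NCC}(n+1,k)$ is the set of such configurations on $n$ vertices for which the number of proper edges plus the number of loops equals $k-1$. $\mathrm{rot}_n$ rotates by one step, $i\mapsto i+1\pmod n$.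 *)

(* Defs.v *)
From HB Require Import structures.
From mathcomp Require Import all_boot all_order all_algebra all_fingroup all_solvable.

Set Implicit Arguments.
Unset Strict Implicit.
Unset Printing Implicit Defensive.

Import GroupScope GRing.Theory Num.Theory.
Local Open Scope ring_scope.

Definition expgz (gT : finGroupType) (g : gT) (d : int) : gT :=
  match d with
  | Posz j => (g ^+ j)%g
  | Negz j => ((g ^+ j.+1)^-1)%g
  end.

(* Cyclic sieving for the action [to] of the cyclic group [G], of order [N] and
   with generator [g], on the finite set [X]. The field [C] plays the role of
   the complex numbers. *)
Definition cyclic_sieving (C : numClosedFieldType) (gT : finGroupType)
    (T : finType) (to : {action gT &-> T}) (X : {set T})
    (N : nat) (G : {group gT}) (g : gT) (f : {poly int}) : Prop :=
  [/\ #|G| = N, generator G g, [acts G, on X | to],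
      forall i : nat, 0 <= f`_i
    & forall (xi : C), N.-primitive_root xi -> forall d : int,
        #|'Fix_(X | to)[expgz g d]|%:R = (map_poly intr f).[xi ^ d] ].

Definition qint (m : nat) : {poly int} := \sum_(i < m) 'X^i.

Definition qfact (m : nat) : {poly int} := \prod_(i < m) qint i.+1.

(* The quotients below are taken in the field of rational functions, so that no
   divisibility is built into the definitions. *)
Definition qbinom (m : nat) (r : int) : {fraction {poly int}} :=
  if r is Posz j then
    if (j <= m)%N
    then tofrac (qfact m) / (tofrac (qfact j) * tofrac (qfact (m - j)))
    else 0
  else 0.

Definition qNarayana (m k : nat) : {fraction {poly int}} :=
  tofrac 'X^(k * (k - 1)) / tofrac (qint m)
    * qbinom m k%:Z * qbinom m (k%:Z - 1).

(* The vertices around the circle are 0, ..., n - 1. *)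
Definition crossing (n : nat) (e f : {set 'I_n}) : bool :=
  [exists a : 'I_n, exists b : 'I_n, exists c : 'I_n, exists d : 'I_n,
    [&& (a < b)%N, (b < c)%N, (c < d)%N,
        e == [set a; c] & f == [set b; d]]].

(* A configuration is the set of the endpoint sets of its proper edges (two
   elements) and of its loops (one element). By [trivIset], proper edges share
   no endpoint and no loop sits on a vertex of a proper edge. *)
Definition noncrossing_config (n : nat) (c : {set {set 'I_n}}) : bool :=
  [&& [forall e in c, (#|e| == 1)%N || (#|e| == 2)%N],
      trivIset c
    & [forall e in c, forall f in c, ~~ crossing e f]].

(* Configurations on [n] vertices with [k - 1] proper edges and loops in total,
   hence none when [k = 0]. *)
Definition NCC (n k : nat) : {set {set {set 'I_n}}} :=
  [set c | noncrossing_config c & (#|c|.+1 == k)%N].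

(* The permutation i |-> i + 1 mod n of the vertices; it acts on
   configurations through the library action ['P^*^*]. *)
Definition rot_perm (n : nat) : {perm 'I_n} := perm (@ordS_inj n).

(* Main.v *)
Require Import Defs.
From HB Require Import structures.
From mathcomp Require Import all_boot all_order all_algebra all_fingroup all_solvable.
From mathcomp Require Import zify ring.

Import GroupScope GRing.Theory Num.Theory.
Local Open Scope ring_scope.

(** Write r = k - 1, and let E_r be the r-th elementary symmetric function of
    q, q^2, ..., q^n ([qesym]).  As E_r is q^(r(r+1)/2) times a Gaussian binomial,
    the q-Narayana polynomial of (n+1, k) is the minor E_r^2 - E_(r-1) E_(r+1)
    ([qnar], [qnar_frac]).  This shows at once that it is a polynomial, and Pascal's
    recurrence shows that all these minors have nonnegative coefficients
    ([qesym_minor_ge0]).  It also makes the values at roots of unity immediate: if z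
    has order o and n = o m, then prod_i (1 + z^i t) over i = 1..n is
    (1 - (-t)^o)^m, so the minor is C(m, r/o)^2 or 0 when o >= 3, it is
    C(m, floor(r/2)) C(m, ceil(r/2)) when o = 2, and it is
    C(n,r)^2 - C(n,r-1) C(n,r+1) when o = 1.

    It remains to count the configurations with r blocks (edges and loops) that are
    invariant under the rotation by m steps.  Unroll the circle into the line of
    natural numbers read modulo n.  If o >= 2, an edge of an invariant configuration
    spans at most m steps on one of its two sides, since otherwise it would cross its
    own rotation; this side orients the edge, except for a diameter, which is only
    possible when o = 2.  If o = 1, orient edges from the smaller to the larger
    vertex.  Let A be the set of residues modulo m of the starting points and the
    loops, and B that of the end points and the loops; the residue of the ends of
    a diameter goes to A only.  Reading A as steps up and B as steps down gives a
    periodic lattice path, and because the edges do not cross, the end of an edge is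
    the place where the path first comes back to its height before the start
    ([cfg_link_word_link]).  Hence
    (A, B) determines the configuration, and conversely the rule of first returns
    turns every admissible pair into an invariant configuration ([card_fixed_configs]).
    The number of blocks is o (|A| + |B|) / 2.  The admissible pairs are: |A| = |B| if
    o >= 3; |A| = |B| or |A| = |B| + 1 (a diameter) if o = 2; |A| = |B| with a path
    that stays nonnegative if o = 1.  Choosing A and B independently, respectively the
    ballot count [nballotE], gives the values found above. *)

(** * The q-Narayana polynomial as a minor of elementary symmetric functions *)

(** The generating function of the [qesym], in a variable over the ring Z[q]. *)
Definition rising (n : nat) : {poly {poly int}} :=
  \prod_(i < n) (1 + ('X^(i.+1))%:P * 'X).

Definition qesym (n r : nat) : {poly int} := (rising n)`_r.

(** The coefficient of [rising] shifted by the variable is [qesym n r.-1], and is 0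
    for r = 0. *)
Definition qnar (n r : nat) : {poly int} :=
  qesym n r ^+ 2 - ('X * rising n)`_r * qesym n r.+1.

Lemma risingS n : rising n.+1 = rising n * (1 + ('X^(n.+1))%:P * 'X).
Proof. by rewrite /rising big_ord_recr. Qed.

Lemma qesym0 n : qesym n 0 = 1.
Proof.
elim: n => [|n IHn]; first by rewrite /qesym /rising big_ord0 coef1.
by rewrite /qesym risingS mulrDr mulr1 mulrCA coefD coefCM coefMX mulr0 addr0.
Qed.

Lemma qesymS n r : qesym n.+1 r.+1 = qesym n r.+1 + 'X^(n.+1) * qesym n r.
Proof. by rewrite /qesym risingS mulrDr mulr1 mulrCA coefD coefCM coefMX. Qed.

Lemma qesym_big n r : (n < r)%N -> qesym n r = 0.
Proof.
elim: n r => [|n IHn] [|r] // ltnr.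
  by rewrite /qesym /rising big_ord0 coef1.
by rewrite qesymS !IHn ?mulr0 ?addr0 // ltnW.
Qed.

Lemma qintD a b : qint (a + b) = qint a + 'X^a * qint b.
Proof.
rewrite /qint big_split_ord /= mulr_sumr; congr (_ + _).
by apply: eq_bigr => i _; rewrite exprD.
Qed.

Lemma qfactS n : qfact n.+1 = qfact n * qint n.+1.
Proof. by rewrite /qfact big_ord_recr. Qed.

Lemma qint_neq0 n : qint n.+1 != 0.
Proof.
apply/eqP => /(congr1 (fun p : {poly int} => p`_0)) /eqP.
by rewrite /qint big_ord_recl coefD coef0 coef_sum big1 ?coefXn // => i _; rewrite coefXn.
Qed.

Lemma qfact_neq0 n : qfact n != 0.
Proof. by rewrite prodf_seq_neq0; apply/allP => i _; rewrite qint_neq0. Qed.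

(** The q-binomial theorem, in a form without division. *)
Lemma qesym_fact n r : (r <= n)%N ->
  qesym n r * (qfact r * qfact (n - r)) = 'X^('C(r.+1, 2)) * qfact n.
Proof.
elim: n r => [|n IHn] [|r] //.
- by move=> _; rewrite qesym0 /qfact !big_ord0 bin_small // !mulr1.
- by move=> _; rewrite qesym0 subn0 bin_small // expr0 /qfact big_ord0 !mul1r.
rewrite ltnS => le_rn; rewrite qesymS subSS mulrDl.
have E2 : 'X^(n.+1) * qesym n r * (qfact r.+1 * qfact (n - r))
   = 'X^('C(r.+1, 2)) * qfact n * ('X^(n.+1) * qint r.+1).
  by rewrite -(IHn r le_rn) qfactS; ring.
have E1 : qesym n r.+1 * (qfact r.+1 * qfact (n - r))
   = 'X^('C(r.+2, 2)) * qfact n * qint (n - r).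
  case: (ltnP r n) => [lt_rn|le_nr].
    by rewrite -(IHn r.+1 lt_rn) -(subnSK lt_rn) !qfactS; ring.
  rewrite qesym_big // (_ : (n - r)%N = 0%N); last by apply/eqP; rewrite subn_eq0.
  by rewrite /qint big_ord0 mul0r mulr0.
rewrite E1 E2 qfactS.
have -> : qint n.+1 = qint (n - r) + 'X^(n - r) * qint r.+1.
  by rewrite -qintD; congr qint; lia.
rewrite (binS r.+1 1) bin1 exprD.
have -> : 'X^(n.+1) = 'X^(r.+1) * 'X^(n - r) :> {poly int}.
  by rewrite -exprD; congr ('X^_); lia.
ring.
Qed.

(** After multiplication by (q - 1)^2 both sides become
    (q - 1) (q^(a+b+1) - 1). *)
Lemma qint_detE a b :
  qint a.+1 * qint b.+1 - 'X * (qint a * qint b) = qint (a + b).+1.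
Proof.
have E i : ('X - 1) * qint i = 'X^i - 1.
  by rewrite (subrX1 'X i); congr (_ * _).
have x1 : ('X - 1 : {poly int}) != 0 by rewrite -[1]/(1%:P) polyXsubC_eq0.
apply: (mulfI x1); apply: (mulfI x1).
have -> : ('X - 1) * (('X - 1) * (qint a.+1 * qint b.+1 - 'X * (qint a * qint b)))
  = (('X - 1) * qint a.+1) * (('X - 1) * qint b.+1)
    - 'X * ((('X - 1) * qint a) * (('X - 1) * qint b)) by ring.
rewrite !E !exprS exprD; ring.
Qed.

(** After clearing denominators, the two terms of the minor differ only by the factors
    of [qint_detE], whose difference is [qint n.+1]. *)
Lemma qnar_fact n r : (r <= n)%N ->
  qnar n r * (qfact r * qfact (n - r) * (qfact r.+1 * qfact (n - r).+1))
    = 'X^(r.+1 * r)%N * (qfact n * qfact n.+1).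
Proof.
move=> le_rn.
have E1 := qesym_fact _ _ le_rn.
have E2 : ('X * rising n)`_r * qesym n r.+1
     * (qfact r * qfact (n - r) * (qfact r.+1 * qfact (n - r).+1))
   = 'X^((r.+1 * r).+1) * (qfact n * qfact n) * (qint r * qint (n - r)).
  case: r le_rn {E1} => [|r] lt_rn.
    by rewrite coefXM /qint big_ord0; ring.
  rewrite coefXM /=.
  case: (ltnP r.+1 n) => [lt_r1n|le_nr]; last first.
    rewrite qesym_big // (_ : (n - r.+1)%N = 0%N); last by apply/eqP; rewrite subn_eq0.
    by rewrite /qint big_ord0; ring.
  have F1 := qesym_fact _ _ (ltnW lt_rn); have F2 := qesym_fact _ _ lt_r1n.
  have -> : ((r.+2 * r.+1).+1 = 'C(r.+1, 2) + 'C(r.+3, 2))%N.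
    rewrite !bin2 /=; have := odd_double_half (r.+1 * r).
    by have := odd_double_half (r.+3 * r.+2); rewrite !oddM /=; lia.
  have -> : 'X^('C(r.+1, 2) + 'C(r.+3, 2)) * (qfact n * qfact n) =
     ('X^('C(r.+1, 2)) * qfact n) * ('X^('C(r.+3, 2)) * qfact n) :> {poly int}.
    by rewrite exprD; ring.
  rewrite -F1 -F2 -[(n - r)%N](subnSK lt_rn) -[(n - r.+1)%N](subnSK lt_r1n) !qfactS.
  by rewrite /qesym; ring.
rewrite /qnar mulrBl E2.
have -> : qesym n r ^+ 2 * (qfact r * qfact (n - r) * (qfact r.+1 * qfact (n - r).+1))
   = (qesym n r * (qfact r * qfact (n - r))) ^+ 2 * (qint r.+1 * qint (n - r).+1).
  by rewrite !qfactS; ring.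
rewrite E1 exprMn -exprM.
have -> : ('C(r.+1, 2) * 2 = r.+1 * r)%N.
  by rewrite bin2 /=; have := odd_double_half (r.+1 * r); rewrite oddM /=; lia.
have := qint_detE r (n - r); rewrite subnKC // qfactS => <-.
by rewrite (exprS 'X (r.+1 * r)%N); ring.
Qed.

(** Here a, b, c, d, e are the q-factorials of n, r, n - r, r + 1, n - r + 1, f is
    [qint n.+1], and x is a power of q. *)
Lemma qNarayana_quotient (F : fieldType) (a b c d e f x : F) :
  b != 0 -> c != 0 -> d != 0 -> e != 0 -> f != 0 ->
  x * (a * (a * f)) = x / f * (a * f / (d * c)) * (a * f / (b * e)) * (b * c * (d * e)).
Proof. by move=> b0 c0 d0 e0 f0; field; rewrite b0 c0 d0 e0 f0. Qed.

Lemma qnar_frac n r : (r <= n)%N -> tofrac (qnar n r) = qNarayana n.+1 r.+1.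
Proof.
move=> le_rn; rewrite /qNarayana.
have -> : (r.+1%:Z - 1 = r%:Z)%R by lia.
rewrite /qbinom ltnS le_rn (leqW le_rn) (subSn le_rn) !subSS subn0 /=.
have := qnar_fact _ _ le_rn.
move/(congr1 (@tofrac _)); rewrite !tofracM (qfactS n) !tofracM.
have nz p : p != 0 :> {poly int} -> tofrac p != 0 by rewrite tofrac_eq0.
have := (nz _ (qfact_neq0 n), nz _ (qfact_neq0 r), nz _ (qfact_neq0 (n - r)),
   nz _ (qfact_neq0 r.+1), nz _ (qfact_neq0 (n - r).+1), nz _ (qint_neq0 n)).
move=> [] [] [] [] [] h1 h2 h3 h4 h5 h6 E.
apply: (mulIf (mulf_neq0 (mulf_neq0 h2 h3) (mulf_neq0 h4 h5))).
apply: etrans E _.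
exact: (qNarayana_quotient _ (tofrac (qfact n)) _ _ _ _ (tofrac (qint n.+1))
  (tofrac 'X^(r.+1 * r)%N) h2 h3 h4 h5 h6).
Qed.

Definition coef_ge0 (p : {poly int}) : Prop := forall i, 0 <= p`_i.

Lemma coef_ge0D p q : coef_ge0 p -> coef_ge0 q -> coef_ge0 (p + q).
Proof. by move=> p0 q0 i; rewrite coefD addr_ge0. Qed.

Lemma coef_ge0M p q : coef_ge0 p -> coef_ge0 q -> coef_ge0 (p * q).
Proof. by move=> p0 q0 i; rewrite coefM sumr_ge0 // => j _; rewrite mulr_ge0. Qed.

Lemma coef_ge0_0 : coef_ge0 0.
Proof. by move=> i; rewrite coef0. Qed.

Lemma coef_ge0Xn j : coef_ge0 'X^j.
Proof. by move=> i; rewrite coefXn; case: eqP. Qed.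

Lemma qesym_ge0 n r : coef_ge0 (qesym n r).
Proof.
elim: n r => [|n IHn] [|r]; try by rewrite qesym0; apply: (coef_ge0Xn 0).
  by rewrite qesym_big //; apply: coef_ge0_0.
by rewrite qesymS; apply/coef_ge0D/coef_ge0M/IHn/coef_ge0Xn.
Qed.

(** Expanding both factors by Pascal's recurrence writes a minor for n + 1 as a
    combination of minors for n with nonnegative coefficients.  The only one out of
    the range a <= b is that with a = b + 1, which has two equal terms and vanishes. *)
Lemma qesym_minor_ge0 n a b : (a <= b)%N ->
  coef_ge0 (qesym n a.+1 * qesym n b.+1 - qesym n a * qesym n b.+2).
Proof.
elim: n a b => [|n IHn] a b le_ab.
  rewrite (qesym_big 0 b.+2) // (qesym_big 0 b.+1) // !mulr0 subr0; exact: coef_ge0_0.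
pose e := qesym n; pose x : {poly int} := 'X^(n.+1).
have M_ge0 c d : (c <= d.+1)%N -> coef_ge0 (e c.+1 * e d.+1 - e c * e d.+2).
  rewrite leq_eqVlt => /orP[/eqP->|]; last by rewrite ltnS; apply: IHn.
  by rewrite mulrC subrr; apply: coef_ge0_0.
have e_ge0 i : coef_ge0 (e i) by apply: qesym_ge0.
have x_ge0 : coef_ge0 x by apply: coef_ge0Xn.
rewrite !qesymS; case: a le_ab => [|a] le_ab.
  rewrite !qesym0 -/e -/x.
  rewrite (_ : _ - _ = (e 1%N * e b.+1 - e 0%N * e b.+2) + x * (e 1%N * e b)
                         + x * x * e b); last by rewrite /e qesym0; ring.
  by repeat first [exact: e_ge0 | exact: M_ge0 | assumption | apply: coef_ge0D | apply: coef_ge0M].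
rewrite !qesymS -/e -/x.
case: b le_ab => // b le_ab.
rewrite (_ : _ - _ = (e a.+2 * e b.+2 - e a.+1 * e b.+3)
   + x * ((e a.+2 * e b.+1 - e a.+1 * e b.+2) + (e a.+1 * e b.+2 - e a * e b.+3))
   + x * x * (e a.+1 * e b.+1 - e a * e b.+2)); last by ring.
by repeat first [exact: e_ge0 | apply: M_ge0; lia | assumption
  | apply: coef_ge0D | apply: coef_ge0M].
Qed.

Lemma qnar_ge0 n r : coef_ge0 (qnar n r).
Proof.
rewrite /qnar expr2; case: r => [|r]; rewrite coefXM /=.
  by rewrite mul0r subr0; apply: coef_ge0M; apply: qesym_ge0.
exact: qesym_minor_ge0.
Qed.

(** * Values at roots of unity *)

(** Substitute -X in the factorization of X^o - 1: the factor -X - z^i is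
    -z^i (1 + z^(o-i) X).  The product of the constants -z^i is found by evaluation
    at 0. *)
Lemma prod_root_of_unity (F : fieldType) (o : nat) (z : F) :
  o.-primitive_root z ->
  \prod_(i < o) (1 + (z ^+ i.+1)%:P * 'X) = 1 - (- 'X) ^+ o :> {poly F}.
Proof.
move=> z_prim.
have o_gt0 := prim_order_gt0 z_prim.
have := congr1 (comp_poly (- 'X)) (factor_Xn_sub_1 z_prim).
rewrite big_mkord rmorph_prod /= comp_polyB comp_Xn_poly comp_polyC.
set P := \prod_(i < o) _.
have -> : P = (\prod_(i < o) - z ^+ i)%:P * \prod_(i < o) (1 + (z ^+ i.+1)%:P * 'X).
  rewrite [X in _ = _ * X](reindex_inj rev_ord_inj) /= rmorph_prod -big_split /=.
  apply: eq_bigr => i _; rewrite comp_polyB comp_polyX comp_polyC /= subnSK // mulrDr mulr1 mulrA.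
  rewrite polyCN mulNr -polyCM -exprD subnKC ?(prim_expr_order z_prim) ?(ltnW (ltn_ord i)) //.
  by rewrite mulN1r addrC.
move=> E; have := congr1 (fun p => p.[0]) E.
rewrite hornerM hornerC horner_prod [X in _ * X]big1 ?mulr1; last first.
  by move=> i _; rewrite hornerD hornerMX mulr0 addr0 hornerC.
rewrite hornerD horner_exp !hornerE oppr0 expr0n gtn_eqF // sub0r => c_eq.
by move: E; rewrite c_eq polyCN mulN1r => /(congr1 -%R); rewrite opprK opprB.
Qed.

Lemma map_rising (R : comNzRingType) (f : {rmorphism {poly int} -> R}) n :
  map_poly f (rising n) = \prod_(i < n) (1 + (f 'X ^+ i.+1)%:P * 'X).
Proof.
rewrite /rising rmorph_prod; apply: eq_bigr => i _.
rewrite rmorphD rmorph1 rmorphM /= map_polyX; congr (_ + _ * _).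
by rewrite map_polyC /= rmorphXn.
Qed.

Lemma prod_periodic (R : comNzRingType) (F : nat -> R) (m o : nat) :
  (forall i, F (i + o)%N = F i) ->
  \prod_(i < m * o) F i = (\prod_(i < o) F i) ^+ m.
Proof.
move=> F_per; elim: m => [|m IHm]; first by rewrite mul0n big_ord0.
rewrite mulSnr big_split_ord /= IHm exprSr; congr (_ * _).
apply: eq_bigr => i _; elim: m {IHm} => [//|m IHm].
by rewrite mulSnr addnAC F_per.
Qed.

Lemma qnar_morph (R : comNzRingType) (f : {rmorphism {poly int} -> R}) n r :
  f (qnar n r) = (map_poly f (rising n))`_r ^+ 2
    - ('X * map_poly f (rising n))`_r * (map_poly f (rising n))`_r.+1.
Proof.
rewrite /qnar /qesym rmorphB !expr2 !rmorphM /= -(map_polyX f).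
by rewrite -(rmorphM (map_poly f)) !coef_map.
Qed.

Lemma qnar_root (C : numClosedFieldType) (m o r : nat) (z : C) :
  o.-primitive_root z ->
  let q := (1 - (- 'X) ^+ o) ^+ m : {poly C} in
  (map_poly intr (qnar (m * o) r)).[z] = q`_r ^+ 2 - ('X * q)`_r * q`_r.+1.
Proof.
move=> z_prim q.
pose ev : {rmorphism {poly int} -> C} := horner_eval z \o map_poly intr.
have q_def : q = map_poly ev (rising (m * o)).
  rewrite map_rising /= map_polyX horner_evalE hornerX /q -(prod_root_of_unity _ _ _ z_prim).
  rewrite (prod_periodic _ (fun i => 1 + (z ^+ i.+1)%:P * 'X)) // => i.
  by rewrite -addSn exprD (prim_expr_order z_prim) mulr1.
by rewrite -[LHS]/(ev _) qnar_morph q_def.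
Qed.

Lemma coef_one_sub_Xn (C : comNzRingType) (m o i : nat) : (0 < o)%N ->
  ((1 - (- 'X) ^+ o) ^+ m : {poly C})`_i
    = if (o %| i)%N then (-1) ^+ (o.+1 * (i %/ o)) *+ 'C(m, i %/ o) else 0.
Proof.
move=> o_gt0; rewrite exprDn coef_sum.
have coefE (j : nat) : ((1 ^+ (m - j) * (- (- 'X) ^+ o) ^+ j : {poly C}) *+ 'C(m, j))`_i
    = (-1) ^+ (o.+1 * j) * (i == o * j)%N%:R *+ 'C(m, j).
  rewrite expr1n mul1r exprNn (exprNn 'X) exprMn -!exprM mulrA -exprD -mulSn coefMn.
  by rewrite -polyCN -polyC_exp coefCM coefXn.
under eq_bigr => j _ do rewrite coefE.
case: ifP => [/dvdnP[j ->]|ndvd].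
  rewrite mulnK //; case: (leqP j m) => [le_jm|gt_jm]; last first.
    rewrite bin_small // mulr0n big1 // => k _; rewrite (mulnC o k) eqn_pmul2r //.
    by rewrite gtn_eqF ?mulr0 ?mul0rn //; have := ltn_ord k; lia.
  rewrite (bigD1 (Ordinal (leq_ltn_trans le_jm (ltnSn m)))) //= big1 ?addr0.
    by rewrite (mulnC o j) eqxx mulr1.
  move=> k; rewrite -val_eqE /= => ne_kj; rewrite (mulnC o k) eqn_pmul2r //.
  by rewrite eq_sym (negPf ne_kj) mulr0 mul0rn.
rewrite big1 // => k _; case: eqP => [i_eq|]; last by rewrite mulr0 mul0rn.
by rewrite i_eq dvdn_mulr in ndvd.
Qed.

(** Only the exponents divisible by o occur in (1 - (-X)^o)^m, and r - 1 and r + 1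
    are not both divisible by o. *)
Lemma qnar_root_ge3 (C : numClosedFieldType) (m o r : nat) (z : C) :
  (2 < o)%N -> o.-primitive_root z ->
  (map_poly intr (qnar (m * o) r)).[z] = (if (o %| r)%N then 'C(m, r %/ o) ^ 2 else 0)%N%:R.
Proof.
move=> o_gt2 z_prim; have o_gt0 : (0 < o)%N by lia.
rewrite qnar_root //= coefXM !coef_one_sub_Xn //.
have -> : (if r == 0%N then 0 else
    if (o %| r.-1)%N then (-1) ^+ (o.+1 * (r.-1 %/ o)) *+ 'C(m, r.-1 %/ o) else 0 : C) *
  (if (o %| r.+1)%N then (-1) ^+ (o.+1 * (r.+1 %/ o)) *+ 'C(m, r.+1 %/ o) else 0) = 0.
  case: r => [|r] /=; first by rewrite mul0r.
  case: ifP => [o_r|]; last by rewrite mul0r.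
  rewrite -addn2 (dvdn_addr _ o_r) ifF ?mulr0 //.
  by apply/negP => /dvdn_leq; lia.
rewrite subr0; case: ifP => _; last by rewrite expr0n.
by rewrite natrX -mulr_natr exprMn -exprM [(_ * 2)%N]mulnC exprM sqrrN !expr1n mul1r.
Qed.

(** If r is even only the square contributes.  If r is odd only the other term does,
    and its two factors have opposite signs. *)
Lemma qnar_root_2 (C : numClosedFieldType) (m r : nat) (z : C) :
  2.-primitive_root z ->
  (map_poly intr (qnar (m * 2) r)).[z] = ('C(m, r./2) * 'C(m, uphalf r))%N%:R.
Proof.
move=> z_prim; rewrite qnar_root //= coefXM !coef_one_sub_Xn // !dvdn2 !divn2 /=.
rewrite natrM; have sgn j : (-1) ^+ (3 * j) = (-1) ^+ j :> C.
  by rewrite exprM -signr_odd.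
case: r => [|r] /=; first by rewrite !bin0 muln0 expr0 mulr1n mul0r subr0 expr1n mulr1.
rewrite !negbK; case: (boolP (odd r)) => odd_r; rewrite ?mulr0 ?mul0r ?subr0 ?expr0n ?sub0r /= !sgn.
  rewrite uphalf_half odd_r add1n -[_ *+ _]mulr_natr exprMn -exprM mulnC exprM sqrrN !expr1n mul1r.
  by rewrite expr2.
rewrite uphalf_half (negPf odd_r) add0n -[_ *+ _]mulr_natr -[X in _ * X]mulr_natr exprS.
rewrite mulN1r mulNr mulrN opprK mulrACA -expr2 -exprM mulnC exprM sqrrN !expr1n mul1r.
by [].
Qed.

Lemma qnar_root_1 (C : numClosedFieldType) (n r : nat) (z : C) :
  1.-primitive_root z ->
  (map_poly intr (qnar n r)).[z]
    = ('C(n, r) ^ 2)%N%:R - ((0 < r) * 'C(n, r.-1) * 'C(n, r.+1))%N%:R.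
Proof.
move=> z_prim; rewrite -{1}[n]muln1 qnar_root //= coefXM !coef_one_sub_Xn // !dvd1n !divn1.
have sgn j : (-1) ^+ (2 * j) = 1 :> C by rewrite exprM sqrrN !expr1n.
rewrite !sgn -natrX; congr (_ - _).
by case: r => [|r]; rewrite ?mul0r // mul1n -natrM.
Qed.

(** * Heights of a periodic word, and the links that it determines *)

(** [up] and [down] are the steps of a lattice path; a position where both hold is a
    flat step and stands for a loop. *)
Section Heights.
Local Open Scope nat_scope.
Variables (m : nat) (up down : nat -> bool).

Definition height (x : nat) : int := (\sum_(t < x) ((up t)%:Z - (down t)%:Z))%R.

Definition climbs (x y : nat) : bool :=
  [forall z : 'I_y.+1, (x < z) ==> (height x < height z)%R].

(** The first return: the path climbs at x, and the step at y is the first that brings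
    it back to the height before x. *)
Definition arch (x y : nat) : bool :=
  [&& x < y, climbs x y & (height y.+1 <= height x)%R].

(** When the path gains height 1 in each period, one step up per period is never
    matched.  Linking it with its translate by a period produces the diameter of the
    configuration; [climbs x (x + m)] tests that there is no return. *)
Definition word_link (x y : nat) : bool :=
  arch x y || climbs x (x + m) && (y == x + m).

Lemma heightS x : height x.+1 = (height x + ((up x)%:Z - (down x)%:Z))%R.
Proof. by rewrite /height big_ord_recr. Qed.

Lemma climbsP x y :
  reflect (forall z, x < z <= y -> (height x < height z)%R) (climbs x y).
Proof.
apply: (iffP forallP) => [h z /andP[lt_xz le_zy]|h z].
  by have /implyP := h (Ordinal (n := y.+1) (m := z) le_zy); apply.
by apply/implyP => lt_xz; apply: h; rewrite lt_xz -ltnS ltn_ord.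
Qed.

Lemma archP x y : reflect
  [/\ x < y, forall z, x < z <= y -> (height x < height z)%R
    & (height y.+1 <= height x)%R] (arch x y).
Proof.
by apply: (iffP and3P) => -[? h ?]; split=> //; apply/climbsP.
Qed.

Lemma arch_close x y : arch x y ->
  [/\ ~~ up y, down y & height y.+1 = height x].
Proof.
case/archP=> lt_xy h h1; have /= := h y; rewrite lt_xy leqnn => /(_ isT).
by move: h1; rewrite heightS; case: (up y); case: (down y) => /= *; split=> //; lia.
Qed.

Lemma climbs_open x y : x < y -> climbs x y -> up x && ~~ down x.
Proof.
move=> lt_xy /climbsP/(_ x.+1); rewrite ltnSn lt_xy => /(_ isT).
by rewrite heightS; case: (up x); case: (down x) => //=; lia.
Qed.

(** Two starts x < x' with the same end would give the path the same height before x
    and before x', although it is strictly higher all along the arch of x. *)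
Lemma arch_inj x x' y : arch x y -> arch x' y -> x = x'.
Proof.
wlog le_xx' : x x' / x <= x' => [wl xy x'y|].
  by case/orP: (leq_total x x') => le; [apply: wl|apply/esym/wl].
move: le_xx'; rewrite leq_eqVlt => /orP[/eqP//|lt_xx'].
move=> xy x'y; have [_ _ e] := arch_close _ _ xy; have [_ _ e'] := arch_close _ _ x'y.
case/archP: xy => _ /(_ x') h _; case/archP: x'y => lt_x'y _ _.
have := h; rewrite lt_xx' (ltnW lt_x'y) => /(_ isT); lia.
Qed.

Hypothesis m_gt0 : 0 < m.
Hypothesis up_per : forall x, up (x + m) = up x.
Hypothesis down_per : forall x, down (x + m) = down x.

Lemma height_per x : height (x + m) = (height x + height m)%R.
Proof.
elim: x => [|x IHx]; first by rewrite add0n /height big_ord0 add0r.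
by rewrite addSn !heightS IHx up_per down_per; lia.
Qed.

Lemma climbs_per x y : climbs (x + m) (y + m) = climbs x y.
Proof.
apply/climbsP/climbsP => h z hz.
  by have := h (z + m); rewrite !height_per; lia.
have -> : z = (z - m) + m by lia.
by have := h (z - m); rewrite !height_per; lia.
Qed.

Lemma word_link_per x y : word_link (x + m) (y + m) = word_link x y.
Proof.
rewrite /word_link /arch ltn_add2r !climbs_per -addSn !height_per.
by rewrite eqn_add2r; congr ([&& _, _ & _] || _); lia.
Qed.

Hypothesis slope01 : (0 <= height m <= 1)%R.

(** If the first return came after more than a period, then the path, which never loses
    height over a period, would have been back one period earlier. *)
Lemma arch_lt x y : arch x y -> y < x + m.
Proof.
case/archP=> lt_xy h h1; rewrite ltnNge; apply/negP => le_y.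
have e : height y.+1 = (height (y.+1 - m) + height m)%R.
  by rewrite -height_per subnK //; lia.
by have := h (y.+1 - m); lia.
Qed.

Lemma word_link_lt x y : word_link x y -> x < y <= x + m.
Proof.
case/orP=> [xy|/andP[_ /eqP->]]; last by lia.
by have := arch_lt _ _ xy; case/archP: xy; lia.
Qed.

Lemma word_link_open x y : word_link x y -> up x && ~~ down x.
Proof.
case/orP=> [/and3P[lt_xy h _]|/andP[h _]]; first exact: climbs_open h.
by apply: climbs_open h; lia.
Qed.

Lemma word_link_fun x y y' : word_link x y -> word_link x y' -> y = y'.
Proof.
wlog le_yy' : y y' / y <= y' => [wl xy xy'|].
  by case/orP: (leq_total y y') => le; [apply: wl|apply/esym/wl].
move: le_yy'; rewrite leq_eqVlt => /orP[/eqP//|lt_yy'] xy xy'.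
have yn := word_link_lt _ _ xy'.
case/orP: xy => [/archP[lt_xy _ h]|/andP[_ /eqP y_eq]]; last by lia.
have: (height x < height y.+1)%R; last by lia.
case/orP: xy' => [/archP[_ h' _]|/andP[/climbsP h' _]]; apply: h'; lia.
Qed.

(** Inside a link the path is above its height at the start; a crossing would have the
    path both above and not above the same height. *)
Lemma word_link_nc x y x' y' :
  word_link x y -> word_link x' y' -> x < x' -> x' < y -> y < y' -> False.
Proof.
move=> xy x'y' lt_xx' lt_x'y lt_yy'.
have hx' : (height x < height x')%R.
  by case/orP: xy => [/archP[_ h _]|/andP[/climbsP h /eqP ?]]; apply: h; lia.
have hy : (height x' < height y)%R.
  by case/orP: x'y' => [/archP[_ h _]|/andP[/climbsP h /eqP ?]]; apply: h; lia.
case/orP: xy => [xy|/andP[h /eqP y_eq]]; last first.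
  by move: hy; rewrite y_eq height_per; lia.
have: (height x' < height y.+1)%R.
  by case/orP: x'y' => [/archP[_ h _]|/andP[/climbsP h /eqP ?]]; apply: h; lia.
by have [_ _ ->] := arch_close _ _ xy; lia.
Qed.

(** Take the first place, if any, where the path is not above its height at x. *)
Lemma word_link_ex x : up x -> ~~ down x -> exists y, word_link x y.
Proof.
move=> alx bex; have hx : height x.+1 = (height x + 1)%R.
  by rewrite heightS alx (negPf bex).
case: (boolP (climbs x (x + m))) => [free|].
  by exists (x + m); rewrite /word_link free eqxx orbT.
rewrite negb_forall => /existsP[z0]; rewrite negb_imply => /andP[lt_xz0 hz0].
have ex : exists z, (x < z) && (height z <= height x)%R.
  by exists z0; rewrite lt_xz0; lia.
case: (ex_minnP ex) => z /andP[lt_xz hz] z_min.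
exists z.-1; apply/orP; left; apply/archP.
have ne : z != x.+1 by apply/eqP => e; move: hz; rewrite e; lia.
split; [lia| |by rewrite prednK //; lia].
by move=> t ht; have := z_min t; case: (boolP (height x < height t)%R) => //; lia.
Qed.

(** Take the last place before y where the path is not above its height after y.  It
    exists because one period earlier the path was not higher. *)
Lemma arch_ex y : down y -> ~~ up y -> m <= y -> exists x, arch x y.
Proof.
move=> bey aly le_my; have hy : height y = (height y.+1 + 1)%R.
  by rewrite heightS bey (negPf aly); lia.
have e : height y.+1 = (height (y.+1 - m) + height m)%R.
  by rewrite -height_per subnK //; lia.
have ex : exists x, (x <= y) && (height x <= height y.+1)%R.
  by exists (y.+1 - m); lia.
have bnd x : (x <= y) && (height x <= height y.+1)%R -> x <= y by case/andP.
case: (ex_maxnP ex bnd) => x /andP[le_xy hx] x_max; exists x.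
have ne : x != y by apply/eqP => e'; move: hx; rewrite e'; lia.
have above z : x < z <= y -> (height y.+1 < height z)%R.
  by move=> hz; have := x_max z; case: (boolP (height y.+1 < height z)%R) => //; lia.
have hx1 : (height y.+1 < height x.+1)%R by apply: above; lia.
have hxe : height x = height y.+1.
  by move: hx1 hx; rewrite (heightS x); case: (up x); case: (down x) => /=; lia.
by apply/archP; split; [lia | rewrite hxe | rewrite hxe].
Qed.
End Heights.

(** * A non-crossing periodic set of links is determined by its word *)

(** [link x y] says that an edge starts at x and ends at y.  A diameter is the only link
    of length m, so that its two ends are linked in a chain. *)
Section Links.
Local Open Scope nat_scope.
Variables (m : nat) (link : rel nat).

Definition opens (x : nat) : bool := has (fun d => link x (x + d.+1)) (iota 0 m).

(** Whether a link of length less than m ends at x.  The end is translated by one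
    period because the start could be negative otherwise. *)
Definition closes (x : nat) : bool :=
  has (fun d => link (x + d.+1) (x + m)) (iota 0 m.-1).

Hypothesis link_lt : forall x y, link x y -> x < y <= x + m.
Hypothesis link_per : forall x y, link (x + m) (y + m) = link x y.

Lemma opensP x : reflect (exists y, link x y) (opens x).
Proof.
apply: (iffP hasP) => [[d _ xd]|[y xy]]; first by exists (x + d.+1).
have lt_xy := link_lt _ _ xy; exists (y - x).-1; first by rewrite mem_iota; lia.
by rewrite (_ : x + _ = y) //; lia.
Qed.

Lemma closesP x : reflect (exists a, link a (x + m) /\ x < a) (closes x).
Proof.
apply: (iffP hasP) => [[d _ xd]|[a [ax lt_xa]]]; first by exists (x + d.+1); split=> //; lia.
have lt_ax := link_lt _ _ ax; exists (a - x).-1; first by rewrite mem_iota; lia.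
by rewrite (_ : x + _ = a) //; lia.
Qed.

Lemma opens_per x : opens (x + m) = opens x.
Proof. by apply: eq_has => d; rewrite -[RHS]link_per (addnAC x m). Qed.

Lemma closes_per x : closes (x + m) = closes x.
Proof. by apply: eq_has => d; rewrite -[RHS]link_per (addnAC x m). Qed.

Lemma closes_link a x : link a x -> x != a + m -> closes x.
Proof.
move=> ax ne; apply/closesP; exists (a + m); rewrite link_per; split=> //.
by have := link_lt _ _ ax; lia.
Qed.

Hypothesis link_fun : forall x y y', link x y -> link x y' -> y = y'.
Hypothesis link_inj : forall x x' y, link x y -> link x' y -> x = x'.
Hypothesis link_chain : forall x y z, link x y -> link y z -> y = x + m.
Hypothesis link_nc : forall x y x' y',
  link x y -> link x' y' -> x < x' -> x' < y -> y < y' -> False.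

(** The link that starts at a has not ended before x; a diameter never ends. *)
Definition pending (a x : nat) : bool :=
  has (fun d => link a (a + d.+1) && ((d.+1 == m) || (x <= a + d.+1))) (iota 0 m).

Lemma pendingP a x :
  reflect (exists b, link a b /\ (b = a + m \/ x <= b)) (pending a x).
Proof.
apply: (iffP hasP) => [[d _ /andP[ad h]]|[b [ab h]]].
  exists (a + d.+1); split=> //; case/orP: h => [/eqP->|]; by [left|right].
have lt_ab := link_lt _ _ ab; exists (b - a).-1; first by rewrite mem_iota; lia.
rewrite (_ : a + _ = b); last by lia.
by rewrite ab /=; lia.
Qed.

(** The number of pending links.  It will turn out to differ from the height by a
    constant, and non-crossing makes its variation along a link evident. *)
Definition depth (x : nat) : nat := \sum_(0 <= a < x) pending a x.

(** Passing x opens the link that starts there and closes the one that ends there.  For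
    x < m that link could have started before 0, whence the hypothesis. *)
Lemma depthS x : m <= x -> depth x.+1 + closes x = depth x + opens x.
Proof.
move=> le_mx; rewrite /depth big_nat_recr //=.
have -> : pending x x.+1 = opens x.
  apply/pendingP/opensP => [[b [xb _]]|[b xb]]; exists b => //; split=> //; right.
  by have := link_lt _ _ xb; lia.
rewrite addnAC; congr (_ + _).
rewrite [RHS](eq_big_nat _ _ (F2 := fun a => pending a x.+1 + (link a x && (x != a + m)))).
  rewrite big_split /=; congr (_ + _).
  case: (boolP (closes x)) => [/closesP[a' [a'x lt_xa']]|cl].
    have := link_lt _ _ a'x => a'_lt.
    have ax : link (a' - m) x by rewrite -link_per subnK //; lia.
    have a'_in : a' - m \in index_iota 0 x by rewrite mem_index_iota; lia.
    rewrite (bigD1_seq _ a'_in) ?iota_uniq //= ax big1 ?addn0; first by apply/eqP; lia.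
    move=> a ne; case: (boolP (link a x)) => // ax'.
    by move: ne; rewrite (link_inj _ _ _ ax' ax) eqxx.
  rewrite big1 // => a _; apply/eqP; rewrite eqb0; apply/negP => /andP[ax ne].
  by move/negP: cl; apply; apply: closes_link ax ne.
move=> a a_lt; case: (boolP (link a x && (x != a + m))) => [/andP[ax ne]|nax].
  have -> : pending a x by apply/pendingP; exists x; split=> //; right.
  suff /negPf-> : ~~ pending a x.+1 by [].
  apply/pendingP => -[b [ab h]]; have := link_fun _ _ _ ab ax; lia.
rewrite addn0; congr (nat_of_bool _); apply/pendingP/pendingP => -[b [ab h]].
  exists b; split=> //; case: h => h; [by left|].
  case: (eqVneq b x) => [e|]; last by right; lia.
  by move: nax; rewrite -e ab /= negbK => /eqP; left.
by exists b; split=> //; case: h => h; [left|right; lia].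
Qed.

Lemma depth_cat x z : x <= z ->
  depth z = \sum_(0 <= a < x) pending a z + \sum_(x <= a < z) pending a z.
Proof. by move=> le_xz; rewrite /depth (big_cat_nat _ (n := x)). Qed.

Lemma depth_lt x z : x < z -> pending x z ->
  (forall a, a < x -> pending a x -> pending a z) -> depth x < depth z.
Proof.
move=> lt_xz xz h; rewrite (depth_cat _ _ (ltnW lt_xz)) [X in _ + X]big_ltn // xz.
suff: depth x <= \sum_(0 <= a < x) pending a z by lia.
rewrite /depth !big_mkord; apply: leq_sum => a _.
by case: (boolP (pending a x)) => // ax; rewrite h.
Qed.

Lemma depth_le x y : x <= y ->
  (forall a, a < y -> pending a y -> a < x /\ pending a x) -> depth y <= depth x.
Proof.
move=> le_xy h; have late0 : \sum_(x <= a < y) pending a y = 0.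
  rewrite big_nat big1 // => a /andP[le_xa lt_ay]; apply/eqP; rewrite eqb0; apply/negP => ay.
  by have [lt_ax _] := h a lt_ay ay; rewrite ltnNge le_xa in lt_ax.
rewrite (depth_cat _ _ le_xy) late0 addn0.
rewrite /depth !big_mkord; apply: leq_sum => a _.
by case: (boolP (pending a y)) => // ay; have [|_ ->] := h a _ ay; first by have := ltn_ord a; lia.
Qed.

(** The links pending at the start of a link are still pending at z, since one that
    ended in between would cross it; and the link itself is pending there too. *)
Lemma link_depth_lt x y z : link x y -> x < z -> (z <= y \/ y = x + m) -> depth x < depth z.
Proof.
move=> xy lt_xz z_le; apply: depth_lt => //.
  by apply/pendingP; exists y; split=> //; case: z_le; [right|left].
move=> a lt_ax /pendingP[b [ab h]]; apply/pendingP; exists b; split=> //.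
case: (leqP z b) => [|lt_bz]; first by right.
left; case: h => // le_xb; move: le_xb; rewrite leq_eqVlt => /orP[/eqP e|lt_xb].
  by apply: link_chain ab _; rewrite -e; apply: xy.
have := link_lt _ _ ab; have := link_lt _ _ xy => h1 h2.
case: (eqVneq b (a + m)) => // ne.
by case: (link_nc _ _ _ _ ab xy) => //; lia.
Qed.

(** A link that starts inside another and is pending after its end would cross it. *)
Lemma link_depth_le x y : link x y -> y != x + m -> depth y.+1 <= depth x.
Proof.
move=> xy ne; have lt_xy := link_lt _ _ xy.
apply: depth_le => [|a lt_ay /pendingP[b [ab h]]]; first by lia.
have := link_lt _ _ ab => lt_ab.
case: (ltngtP a x) => [lt_ax|lt_xa|e].
- by split=> //; apply/pendingP; exists b; split=> //; case: h; [left|right; lia].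
- case: (eqVneq a y) => [e|ne_ay].
    by move: ab; rewrite e => yb; have := link_chain _ _ _ xy yb; lia.
  by case: (link_nc _ _ _ _ xy ab) => //; lia.
- by move: ab; rewrite e => xb; have := link_fun _ _ _ xy xb; lia.
Qed.

Variables (up down : nat -> bool).
Hypothesis m_gt0 : 0 < m.
Hypothesis up_per : forall x, up (x + m) = up x.
Hypothesis down_per : forall x, down (x + m) = down x.
Hypothesis up_down : forall x, up x + closes x = down x + opens x.
Local Notation height := (height up down).

Lemma height_depth x z : m <= x -> x <= z -> (height z - height x = (depth z)%:Z - (depth x)%:Z)%R.
Proof.
move=> le_mx /subnK<-; elim: (z - x) => [|k IHk]; first by rewrite add0n !subrr.
rewrite addSn heightS; have := depthS (k + x); have := up_down (k + x); lia.
Qed.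

(** Depth and height vary in the same way, so every link is a first return, or has no
    return if it is a diameter. *)
Lemma link_word_link x y : link x y -> word_link m up down x y.
Proof.
move=> xy; rewrite -word_link_per //; rewrite -link_per in xy.
have lt_xy := link_lt _ _ xy; apply/orP.
case: (eqVneq (y + m) (x + m + m)) => [e|ne]; [right|left].
  rewrite andbT; apply/climbsP => z hz.
  have := height_depth (x + m) z; have := link_depth_lt _ _ z xy; lia.
apply/archP; split; first by lia.
  move=> z hz; have := height_depth (x + m) z; have := link_depth_lt _ _ z xy; lia.
have := height_depth (x + m) (y + m).+1; have := link_depth_le _ _ xy ne; lia.
Qed.

(** Over one period the depth grows by the number of diameters that start there. *)
Lemma height_slope : height m = \sum_(0 <= a < m) link a (a + m) :> int.
Proof.
have e := height_depth m (m + m); move: e; rewrite height_per //.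
have -> : depth (m + m) = \sum_(0 <= a < m) link a (a + m) + depth m.
  rewrite {1}/depth (big_cat_nat _ (n := m)) //=; last by lia.
  have -> : \sum_(m <= a < m + m) pending a (m + m) = \sum_(0 <= a < m) pending (a + m) (m + m).
    by rewrite -[X in \sum_(X <= _ < _) _]add0n big_addn addnK.
  congr (_ + _); apply: eq_big_nat => a a_lt.
    congr (nat_of_bool _); apply/pendingP/idP => [[b [ab h]]|aam].
      by rewrite -(_ : b = a + m) //; have := link_lt _ _ ab; lia.
    by exists (a + m); split=> //; left.
  congr (nat_of_bool _); apply/pendingP/pendingP => -[b [ab h]].
    have := link_lt _ _ ab => lt_ab; exists (b - m); rewrite -link_per subnK; last by lia.
    by split=> //; case: h => h; [left|right]; lia.
  by exists (b + m); rewrite link_per; split=> //; case: h => h; [left|right]; lia.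
by lia.
Qed.

(** Two diameters starting in the same period would cross. *)
Lemma slope_le1 : (0 <= height m <= 1)%R.
Proof.
rewrite height_slope; apply/andP; split; first by lia.
case: (boolP (has (fun a => link a (a + m)) (iota 0 m))) => [/hasP[u]|nu].
  rewrite mem_iota => u_lt uu.
  have u_in : u \in index_iota 0 m by rewrite mem_index_iota.
  rewrite (bigD1_seq _ u_in) ?iota_uniq //= uu big_nat_cond big1 ?addn0 //.
  move=> a /andP[a_lt ne]; apply/eqP; rewrite eqb0; apply/negP => aa.
  case: (ltngtP u a) ne => [lt_ua|lt_au|] // _.
    by apply: (link_nc _ _ _ _ uu aa); lia.
  by apply: (link_nc _ _ _ _ aa uu); lia.
rewrite big_nat big1 // => a a_lt; apply/eqP; rewrite eqb0; apply/negP => aa.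
by move/hasPn: nu => /(_ a); rewrite mem_iota aa => /(_ a_lt).
Qed.
End Links.

(** * Chords of the circle, lifted to the line *)

Section Circle.
Local Open Scope nat_scope.
Variables (n : nat) (n_gt0 : 0 < n).

Definition vtx (x : nat) : 'I_n := Ordinal (ltn_pmod x n_gt0).
(** [chord x x] is a loop. *)
Definition chord (x y : nat) : {set 'I_n} := [set vtx x; vtx y].

Lemma vtx_eq x y : vtx x = vtx y <-> x = y %[mod n].
Proof. by split=> [/(congr1 val)|e] //; apply/val_inj. Qed.

Lemma vtx_ord (i : 'I_n) : vtx i = i.
Proof. by apply/val_inj; rewrite /= modn_small. Qed.

Lemma vtxDn x k : vtx (x + k * n) = vtx x.
Proof. by apply/vtx_eq; rewrite addnC modnMDl. Qed.

Lemma vtxD x : vtx (x + n) = vtx x.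
Proof. by rewrite -(vtxDn x 1) mul1n. Qed.

Lemma vtxDl x y z : vtx x = vtx y -> vtx (x + z) = vtx (y + z).
Proof. by move/vtx_eq=> e; apply/vtx_eq; apply/eqP; rewrite eqn_modDr; apply/eqP. Qed.

Lemma vtx_gap x y : vtx x = vtx y -> x < y -> x + n <= y.
Proof.
move=> /vtx_eq/eqP e lt_xy; rewrite eq_sym eqn_mod_dvd ?(ltnW lt_xy) // in e.
by have := dvdn_leq _ e; rewrite subn_gt0 lt_xy => /(_ isT); lia.
Qed.

Lemma vtx_le x y : vtx x = vtx y -> x <= y -> exists k, y = x + k * n.
Proof.
move=> /vtx_eq/eqP e le_xy; rewrite eq_sym eqn_mod_dvd // in e.
by case/dvdnP: e => k e; exists k; lia.
Qed.

Lemma chordC x y : chord x y = chord y x.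
Proof. by rewrite /chord setUC. Qed.

Lemma chord_eq x y x' y' : chord x y = chord x' y' ->
  (vtx x = vtx x' /\ vtx y = vtx y') \/ (vtx x = vtx y' /\ vtx y = vtx x').
Proof.
move=> e; have: vtx x \in chord x' y' by rewrite -e set21.
have: vtx y \in chord x' y' by rewrite -e set22.
have: vtx x' \in chord x y by rewrite e set21.
have: vtx y' \in chord x y by rewrite e set22.
rewrite !inE => /orP[]/eqP ? /orP[]/eqP ? /orP[]/eqP ? /orP[]/eqP ?;
  by (left + right); split; congruence.
Qed.

Lemma chord_fun x x' y y' : vtx x = vtx x' -> chord x y = chord x' y' -> vtx y = vtx y'.
Proof. by move=> ex /chord_eq[[]|[]]; congruence. Qed.

Lemma chord_vtx x x' y y' : vtx x = vtx x' -> vtx y = vtx y' -> chord x y = chord x' y'.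
Proof. by rewrite /chord => -> ->. Qed.

Lemma mem_chord p x y : vtx p \in chord x y -> vtx p = vtx x \/ vtx p = vtx y.
Proof. by rewrite !inE => /orP[]/eqP; [left|right]. Qed.

Lemma small_block (e : {set 'I_n}) : (#|e| == 1) || (#|e| == 2) ->
  (exists x, e = chord x x) \/ exists i j : 'I_n, i < j /\ e = chord i j.
Proof.
case/orP=> [/cards1P[i ->]|/cards2P[i [j [ne ->]]]].
  by left; exists i; rewrite /chord setUid vtx_ord.
right; case: (ltngtP i j) => [lt_ij|lt_ji|/val_inj eij]; last by rewrite eij eqxx in ne.
  by exists i, j; rewrite /chord !vtx_ord.
by exists j, i; rewrite chordC /chord !vtx_ord.
Qed.

Definition nc_set (c : {set {set 'I_n}}) : Prop :=
  forall e f, e \in c -> f \in c -> ~~ crossing e f.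

Lemma crossing_chord (x y x' y' : 'I_n) : x < x' -> x' < y -> y < y' ->
  crossing (chord x y) (chord x' y').
Proof.
move=> *; apply/existsP; exists x; apply/existsP; exists x'.
apply/existsP; exists y; apply/existsP; exists y'.
by rewrite /chord !vtx_ord !eqxx; apply/and5P.
Qed.

(** The cyclic form of non-crossing, invariant under translation: the four positions in
    a window of length n need not be ordered by their residues.  Reducing the window to
    start below n, there is one case for each number of positions beyond n. *)
Lemma nc_chord c x y x' y' : nc_set c -> chord x y \in c -> chord x' y' \in c ->
  x < x' -> x' < y -> y < y' -> y' < x + n -> False.
Proof.
move=> c_nc.
wlog lt_xn : x y x' y' / x < n => [wl|].
  move=> xy x'y' h1 h2 h3 h4; have e := divn_eq x n; set k := x %/ n in e.
  have sh z : x <= z -> vtx (z - k * n) = vtx z.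
    by move=> le_xz; rewrite -(vtxDn _ k) subnK //; lia.
  have lt := ltn_pmod x n_gt0.
  apply: (wl (x - k * n) (y - k * n) (x' - k * n) (y' - k * n)); try lia.
    by rewrite (chord_vtx _ x _ y) ?sh //; lia.
  by rewrite (chord_vtx _ x' _ y') ?sh //; lia.
move=> xy x'y' h1 h2 h3 h4.
have chord_low z t (hz : z < n) (ht : t < n) : chord z t = chord (Ordinal hz) (Ordinal ht).
  by [].
have down z t : n <= z -> chord z t = chord (z - n) t.
  by move=> le_nz; apply: chord_vtx => //; rewrite -(vtxD (z - n)) subnK.
have kill a b a' b' : a < a' -> a' < b -> b < b' -> b' < n ->
    chord a b \in c -> chord a' b' \in c -> False.
  move=> l1 l2 l3 l4 ab a'b'.
  have ha : a < n by lia. have ha' : a' < n by lia. have hb : b < n by lia.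
  move: ab a'b'; rewrite (chord_low _ _ ha hb) (chord_low _ _ ha' l4) => ab a'b'.
  by have /negP := c_nc _ _ ab a'b'; apply; apply: crossing_chord.
case: (ltnP x' n) => hx'; last first.
  move: xy x'y'; rewrite (chordC x y) (down y) ?(down x') //; try lia.
  rewrite (chordC _ y') (down y'); last by lia.
  by rewrite (chordC _ (x' - n)) => xy x'y'; apply: kill x'y' xy; lia.
case: (ltnP y n) => hy; last first.
  move: xy x'y'; rewrite (chordC x y) (chordC x' y') (down y) ?(down y') //; try lia.
  by move=> xy x'y'; apply: kill xy x'y'; lia.
case: (ltnP y' n) => hy'; last first.
  by move: x'y'; rewrite (chordC x' y') (down y') // => x'y'; apply: kill x'y' xy; lia.
by apply: kill xy x'y'.
Qed.

Lemma crossingE (e f : {set 'I_n}) : crossing e f ->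
  exists a b a' b' : 'I_n, [/\ a < a', a' < b, b < b', e = chord a b & f = chord a' b'].
Proof.
case/existsP=> a /existsP[a' /existsP[b /existsP[b' /and5P[? ? ? /eqP-> /eqP->]]]].
by exists a, b, a', b'; rewrite /chord !vtx_ord.
Qed.
End Circle.

(** * From an invariant configuration to its word *)

(** The rotation by m steps has order o = n / m on the circle. *)
Section Build.
Local Open Scope nat_scope.
Variables (n : nat) (n_gt0 : 0 < n) (m o : nat).
Hypothesis n_def : n = o * m.
Local Notation vtx := (vtx n n_gt0).
Local Notation chord := (chord n n_gt0).

Lemma period_gt0 : 0 < m.
Proof. by case: m n_def n_gt0 => [|//]; rewrite muln0 => ->. Qed.

Lemma period_le : m <= n.
Proof. by case: o n_def n_gt0 => [|k] -> //; rewrite mulSn leq_addr. Qed.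

Lemma period_eq : o = 1 -> n = m.
Proof. by rewrite n_def => ->; rewrite mul1n. Qed.

Lemma period_double : o != 1 -> m + m <= n.
Proof.
by case: o n_def n_gt0 => [|[|k]] -> // _ _; rewrite !mulSn addnA leq_addr.
Qed.

Lemma periodic_mul (T : Type) (F : nat -> T) : (forall x, F (x + m) = F x) ->
  forall k x, F (x + k * m) = F x.
Proof.
move=> Fm k x; elim: k => [|j IHj]; first by rewrite addn0.
by rewrite mulSnr addnA Fm.
Qed.

Lemma periodic_circle (T : Type) (F : nat -> T) : (forall x, F (x + m) = F x) ->
  forall k x, F (x + k * n) = F x.
Proof. by move=> Fm k x; rewrite n_def mulnA periodic_mul. Qed.

(** The side that orients an edge from x to y: for o = 1 the side that does not pass
    from vertex n - 1 to vertex 0, otherwise the side of length at most m. *)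
Definition short_arc (x y : nat) : bool :=
  (x < y) && (if o == 1 then x %/ n == y %/ n else y <= x + m).

Lemma block_lt x y : x %/ n = y %/ n -> y < x + n.
Proof.
move=> e; rewrite (divn_eq y n) -e [in X in _ < X](divn_eq x n).
by have := ltn_pmod y n_gt0; lia.
Qed.

Lemma short_arc_lt x y : short_arc x y -> x < y <= x + m.
Proof.
case/andP=> ->; case: eqP => // o1 /eqP/block_lt.
by rewrite -(period_eq o1) => /ltnW.
Qed.

Lemma short_arc_ltn x y : short_arc x y -> x < y < x + n.
Proof.
case/andP=> ->; case: eqP => [o1 /eqP/block_lt //|/eqP/period_double].
by have := period_gt0; lia.
Qed.

Lemma short_arc_neq x y : short_arc x y -> vtx x <> vtx y.
Proof. by move/short_arc_ltn=> /andP[lt_xy lt_yn] /vtx_gap -/(_ lt_xy); lia. Qed.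

Lemma short_arc_per x y : short_arc (x + m) (y + m) = short_arc x y.
Proof.
rewrite /short_arc ltn_add2r leq_add2r; case: eqP => // o1.
by rewrite -(period_eq o1) !divnDr // eqn_add2r.
Qed.

Variables (up down : nat -> bool).
Local Notation word_link := (word_link m up down).

(** The loops and links of a word; bounding y by n + m suffices as a link has length at
    most m. *)
Definition build : {set {set 'I_n}} :=
  [set e | [exists x : 'I_n, up x && down x && (e == chord x x)
            || [exists y : 'I_(n + m).+1, word_link x y && (e == chord x y)]]].

Hypothesis up_per : forall x, up (x + m) = up x.
Hypothesis down_per : forall x, down (x + m) = down x.
Hypothesis slope01 : (0 <= height up down m <= 1)%R.

Let m_gt0 := period_gt0.
Let wl_per x y : word_link (x + m) (y + m) = word_link x y.
Proof. exact: word_link_per. Qed.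
Let wl_lt x y : word_link x y -> x < y <= x + m.
Proof. exact: word_link_lt. Qed.

Lemma word_link_perD k x y : word_link (x + k * n) (y + k * n) = word_link x y.
Proof.
rewrite n_def mulnA; elim: (k * o) => [|j IHj]; first by rewrite !addn0.
by rewrite mulSnr !addnA wl_per.
Qed.

Lemma word_link_move x y p : word_link x y -> vtx p = vtx x ->
  exists q, [/\ word_link p q, vtx q = vtx y & y + p = q + x].
Proof.
move=> xy ep; case: (leqP x p) => [le_xp|/ltnW le_px].
  have [k p_eq] := vtx_le _ _ _ _ (esym ep) le_xp.
  by exists (y + k * n); rewrite p_eq word_link_perD vtxDn; split=> //; lia.
have [k x_eq] := vtx_le _ _ _ _ ep le_px.
have lt_xy := wl_lt _ _ xy; exists (y - k * n).
have y_eq : y = y - k * n + k * n by lia.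
split; [|by rewrite [in RHS]y_eq vtxDn|by lia].
by rewrite -(word_link_perD k) -x_eq -y_eq.
Qed.

Lemma buildP e : e \in build <->
  (exists x, up x && down x /\ e = chord x x) \/ (exists x y, word_link x y /\ e = chord x y).
Proof.
rewrite inE; split=> [/existsP[x /orP[/andP[abx /eqP->]|/existsP[y /andP[xy /eqP->]]]]|].
- by left; exists x.
- by right; exists x, y.
case=> [[x [abx ->]]|[x [y [xy ->]]]].
  have ex : vtx x = vtx (vtx x) by rewrite vtx_ord.
  have ep (F : nat -> bool) : (forall x, F (x + m) = F x) -> F (x %% n) = F x.
    by move=> /periodic_circle Fn; rewrite {2}(divn_eq x n) addnC Fn.
  apply/existsP; exists (vtx x); apply/orP; left; rewrite /= !ep // abx /=.
  by apply/eqP; apply: chord_vtx.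
have ex : vtx (vtx x) = vtx x by rewrite vtx_ord.
have [q [xq eq _]] := word_link_move _ _ _ xy ex.
have lt_q : q < (n + m).+1 by have := wl_lt _ _ xq; have := ltn_ord (vtx x); lia.
apply/existsP; exists (vtx x); apply/orP; right; apply/existsP; exists (Ordinal lt_q).
by rewrite /= xq /=; apply/eqP; apply: chord_vtx.
Qed.
End Build.

Section Config.
Local Open Scope nat_scope.
Variables (n : nat) (n_gt0 : 0 < n) (m o : nat).
Hypothesis n_def : n = o * m.
Local Notation vtx := (vtx n n_gt0).
Local Notation chord := (chord n n_gt0).
Local Notation short_arc := (short_arc n m o).

Let m_gt0 := period_gt0 _ n_gt0 _ _ n_def.
Let m_le := period_le _ n_gt0 _ _ n_def.

Variable c : {set {set 'I_n}}.

Definition cfg_link (x y : nat) : bool := short_arc x y && (chord x y \in c).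
(** The word of a configuration.  A loop counts as both up and down, and the two ends of
    a diameter only count as up. *)
Definition cfg_up (x : nat) : bool := (chord x x \in c) || opens m cfg_link x.
Definition cfg_down (x : nat) : bool := (chord x x \in c) || closes m cfg_link x.

Hypothesis c_card : forall e, e \in c -> (#|e| == 1) || (#|e| == 2).
Hypothesis c_triv : trivIset c.
Hypothesis c_nc : nc_set n c.
Hypothesis c_per : forall x y, (chord (x + m) (y + m) \in c) = (chord x y \in c).

Lemma block_unique e f p : e \in c -> f \in c -> p \in e -> p \in f -> e = f.
Proof.
move=> ec fc pe pf; apply/eqP; apply: contraT => ne.
have /trivIsetP/(_ e f ec fc ne) := c_triv.
by move/disjoint_setI0/setP/(_ p); rewrite !inE pe pf.
Qed.

Lemma cfg_link_lt x y : cfg_link x y -> x < y <= x + m.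
Proof. by case/andP=> /(short_arc_lt _ n_gt0 _ _ n_def). Qed.

Lemma cfg_link_ltn x y : cfg_link x y -> x < y < x + n.
Proof. by case/andP=> /(short_arc_ltn _ n_gt0 _ _ n_def). Qed.

Lemma cfg_link_per x y : cfg_link (x + m) (y + m) = cfg_link x y.
Proof. by rewrite /cfg_link (short_arc_per _ _ _ n_def) c_per. Qed.

Lemma cfg_link_fun x y y' : cfg_link x y -> cfg_link x y' -> y = y'.
Proof.
wlog lt_yy' : y y' / y < y' => [wl xy xy'|xy xy'].
  by case: (ltngtP y y') => // lt; [apply: wl|apply/esym/wl].
have := cfg_link_ltn _ _ xy; have := cfg_link_ltn _ _ xy'.
case/andP: xy => _ xy; case/andP: xy' => _ xy'.
have e := block_unique _ _ (vtx x) xy xy' (set21 _ _) (set21 _ _).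
by have := vtx_gap _ _ _ _ (chord_fun _ _ _ _ _ _ erefl e) lt_yy'; lia.
Qed.

Lemma cfg_link_inj x x' y : cfg_link x y -> cfg_link x' y -> x = x'.
Proof.
wlog lt_xx' : x x' / x < x' => [wl xy xy'|xy x'y].
  by case: (ltngtP x x') => // lt; [apply: wl|apply/esym/wl].
have := cfg_link_ltn _ _ xy; have := cfg_link_ltn _ _ x'y.
case/andP: xy => _ xy; case/andP: x'y => _ x'y.
have := block_unique _ _ (vtx y) xy x'y (set22 _ _) (set22 _ _).
rewrite chordC (chordC _ _ x') => e.
by have := vtx_gap _ _ _ _ (chord_fun _ _ _ _ _ _ erefl e) lt_xx'; lia.
Qed.

Lemma cfg_link_chain x y z : cfg_link x y -> cfg_link y z -> y = x + m.
Proof.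
move=> xy yz; have lt_xy := cfg_link_lt _ _ xy; have lt_yz := cfg_link_lt _ _ yz.
case/andP: xy => ax xy; case/andP: yz => ay yz.
have := block_unique _ _ (vtx y) xy yz (set22 _ _) (set21 _ _).
rewrite chordC => /(chord_fun _ _ _ _ _ _ erefl)/vtx_gap gap.
have {}gap : x + n <= z by apply: gap; lia.
case: (eqVneq o 1) => [o1|/(period_double _ n_gt0 _ _ n_def)]; last by lia.
have: z < x + n; last by lia.
apply: (block_lt _ n_gt0 _ _ n_def); move: ax ay; rewrite /short_arc o1 /=.
by move=> /andP[_ /eqP->] /andP[_ /eqP->].
Qed.

Lemma cfg_link_nc x y x' y' :
  cfg_link x y -> cfg_link x' y' -> x < x' -> x' < y -> y < y' -> False.
Proof.
move=> xy x'y' h1 h2 h3; have lt_xy := cfg_link_lt _ _ xy; have lt_x'y' := cfg_link_lt _ _ x'y'.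
case/andP: xy => ax xy; case/andP: x'y' => ax' x'y'.
apply: (nc_chord _ n_gt0 _ _ _ _ _ c_nc xy x'y') => //.
case: (eqVneq o 1) => [o1|/(period_double _ n_gt0 _ _ n_def)]; last by lia.
apply: (block_lt _ n_gt0 _ _ n_def); move: ax ax'; rewrite /short_arc o1 /=.
move=> /andP[_ /eqP e] /andP[_ /eqP <-]; apply/eqP; rewrite eqn_leq.
by rewrite {2}e !leq_div2r // ltnW.
Qed.

Lemma loop_cfg_link p x y : vtx p = vtx x \/ vtx p = vtx y ->
  chord p p \in c -> cfg_link x y -> False.
Proof.
move=> hp pc /andP[ax xy]; apply: (short_arc_neq _ n_gt0 _ _ n_def _ _ ax).
have pxy : vtx p \in chord x y by rewrite !inE; case: hp => ->; rewrite eqxx ?orbT.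
have /chord_eq := block_unique _ _ _ pc xy (set21 _ _) pxy.
by case=> [[]|[]]; congruence.
Qed.

Lemma cfg_up_per x : cfg_up (x + m) = cfg_up x.
Proof. by rewrite /cfg_up c_per opens_per //; apply: cfg_link_per. Qed.

Lemma cfg_down_per x : cfg_down (x + m) = cfg_down x.
Proof. by rewrite /cfg_down c_per closes_per //; apply: cfg_link_per. Qed.

Let c_opensP := opensP m cfg_link cfg_link_lt.
Let c_closesP := closesP m cfg_link cfg_link_lt.
Let c_closes := closes_link m cfg_link cfg_link_lt cfg_link_per.

Lemma loop_open_close x : chord x x \in c ->
  opens m cfg_link x = false /\ closes m cfg_link x = false.
Proof.
move=> xc; split.
  by apply/c_opensP => -[y xy]; apply: (loop_cfg_link x x y) => //; left.
apply/c_closesP => -[a [ax _]]; rewrite -c_per in xc.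
by apply: (loop_cfg_link (x + m) a (x + m)) => //; right.
Qed.

Lemma cfg_up_down x : cfg_up x + closes m cfg_link x = cfg_down x + opens m cfg_link x.
Proof.
rewrite /cfg_up /cfg_down; case: (boolP (chord x x \in c)) => [/loop_open_close[-> ->] //|_ /=].
exact: addnC.
Qed.

Lemma cfg_slope : (0 <= height cfg_up cfg_down m <= 1)%R.
Proof.
exact: (slope_le1 m cfg_link cfg_link_lt cfg_link_per cfg_link_fun cfg_link_inj cfg_link_nc
  cfg_up cfg_down m_gt0 cfg_up_per cfg_down_per cfg_up_down).
Qed.

(** A diameter {x, x + m} and its image share x + m, hence are equal, which forces
    n = 2m. *)
Lemma cfg_slope_half : height cfg_up cfg_down m = 1%R -> o = 2.
Proof.
rewrite (height_slope m cfg_link cfg_link_lt cfg_link_per cfg_link_fun cfg_link_inj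
  cfg_up cfg_down m_gt0 cfg_up_per cfg_down_per cfg_up_down) => s1.
have /hasP[a _ aam] : has (fun a => cfg_link a (a + m)) (index_iota 0 m).
  apply: contraT => /hasPn none; move: s1; rewrite big_seq big1 // => a /none.
  by case: (cfg_link _ _).
have lt := cfg_link_ltn _ _ aam.
have [o1|o1] := eqVneq o 1; first by have := period_eq _ _ _ n_def o1; lia.
have m2 := period_double _ n_gt0 _ _ n_def o1.
have aam2 := aam; rewrite -cfg_link_per in aam2.
case/andP: aam => _ aam; case/andP: aam2 => _ aam2.
have := block_unique _ _ (vtx (a + m)) aam aam2 (set22 _ _) (set21 _ _).
rewrite chordC => /(chord_fun _ _ _ _ _ _ erefl)/vtx_gap gap.
have n_eq : n = 2 * m by have := gap; lia.
by apply/eqP; rewrite -(eqn_pmul2r m_gt0) -n_def n_eq.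
Qed.

(** For o = 1 no link is pending at n, so the depth is 0 there, and from there on the
    height varies as the depth. *)
Lemma cfg_ballot : o = 1 -> forall x, (0 <= height cfg_up cfg_down x)%R.
Proof.
move=> o1 x; have nm := period_eq _ _ _ n_def o1.
have hd := height_depth m cfg_link cfg_link_lt cfg_link_per cfg_link_fun cfg_link_inj
  cfg_up cfg_down m_gt0 cfg_up_down m (x + m) (leqnn _) (leq_addl _ _).
rewrite (height_per _ _ _ m_gt0 cfg_up_per cfg_down_per) addrK in hd.
suff d0 : depth m cfg_link m = 0 by rewrite hd d0 subr0.
rewrite /depth big_nat big1 // => a a_lt; apply/eqP; rewrite eqb0; apply/negP.
case/(pendingP _ _ cfg_link_lt) => b [ab hb]; have lt_ab := cfg_link_ltn _ _ ab.
case/andP: ab => /andP[_]; rewrite o1 /= => /eqP e _.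
have : 0 < b %/ n by rewrite divn_gt0 //; lia.
by rewrite -e divn_small //; lia.
Qed.

Lemma cfg_link_word_link x y : cfg_link x y -> word_link m cfg_up cfg_down x y.
Proof.
exact: (link_word_link m cfg_link cfg_link_lt cfg_link_per cfg_link_fun cfg_link_inj cfg_link_chain
  cfg_link_nc cfg_up cfg_down m_gt0 cfg_up_per cfg_down_per cfg_up_down).
Qed.

Lemma open_close_false x : opens m cfg_link x -> closes m cfg_link x -> False.
Proof.
move=> /c_opensP[y xy] /c_closesP[a [ax lt_xa]]; rewrite -cfg_link_per in xy.
by have := cfg_link_chain _ _ _ ax xy; lia.
Qed.

(** If neither side of an edge had length at most m, then the edge would cross its image
    under the rotation. *)
Lemma block_cases e : e \in c ->
  (exists x, e = chord x x) \/ exists x y, cfg_link x y /\ e = chord x y.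
Proof.
move=> ec; case: (small_block _ n_gt0 _ (c_card _ ec)) => [|[i [j [lt_ij e_eq]]]]; first by left.
right; have lt_jn := ltn_ord j; move: ec; rewrite e_eq => ec.
case: (eqVneq o 1) => [o1|o1].
  exists i, j; rewrite /cfg_link ec andbT /short_arc o1 lt_ij /=.
  by rewrite !divn_small.
have m2 := period_double _ n_gt0 _ _ n_def o1.
have wrap : chord j (i + n) = chord i j by rewrite chordC; apply: chord_vtx; rewrite ?vtxD.
case: (leqP j (i + m)) => [le_j|lt_j].
  by exists i, j; rewrite /cfg_link /short_arc (negPf o1) ec lt_ij le_j.
case: (leqP (i + n) (j + m)) => [le_i|lt_i].
  by exists j, (i + n); rewrite /cfg_link /short_arc (negPf o1) wrap ec le_i; split=> //; lia.
have ec' : chord (i + m) (j + m) \in c by rewrite c_per.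
by case: (nc_chord _ n_gt0 _ _ _ _ _ c_nc ec ec') => //; lia.
Qed.

Lemma cfg_up_down_loop x : cfg_up x && cfg_down x = (chord x x \in c).
Proof.
rewrite /cfg_up /cfg_down; case: (chord x x \in c) => //=; apply/negP => /andP[].
exact: open_close_false.
Qed.

(** Links are first returns, and each step up has at most one first return, so the word
    determines the links. *)
Lemma config_build : c = build n n_gt0 m cfg_up cfg_down.
Proof.
apply/setP => e; apply/idP/idP => [ec|].
  apply/(buildP _ n_gt0 _ _ n_def _ _ cfg_up_per cfg_down_per cfg_slope).
  case: (block_cases _ ec) => [[x ex]|[x [y [xy exy]]]].
    by left; exists x; rewrite cfg_up_down_loop -ex.
  by right; exists x, y; split=> //; apply: cfg_link_word_link.
case/(buildP _ n_gt0 _ _ n_def _ _ cfg_up_per cfg_down_per cfg_slope) => [[x []]|[x [y [xy ->]]]].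
  by rewrite cfg_up_down_loop => xc ->.
have := word_link_open _ _ _ m_gt0 cfg_slope _ _ xy; rewrite {1}/cfg_up /cfg_down negb_or.
case/andP=> alx /andP[lx _]; move: alx; rewrite (negPf lx) /= => /c_opensP[y' xy'].
have -> : y = y'; last by case/andP: xy'.
exact: (word_link_fun _ _ _ m_gt0 cfg_up_per cfg_down_per cfg_slope _ _ _ xy
  (cfg_link_word_link _ _ xy')).
Qed.

(** Each block contributes 2: a loop is both up and down, an edge has an end that is up
    and one that is down, and a diameter has two ends that are up. *)
Lemma config_card : (\sum_(i < n) (cfg_up i + cfg_down i) = #|c| * 2)%N.
Proof.
pose F (i : 'I_n) : nat := cfg_up i + cfg_down i.
have upD k x : cfg_up (x + k * n) = cfg_up x.
  by apply: (periodic_circle _ _ _ n_def); apply: cfg_up_per.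
have downD k x : cfg_down (x + k * n) = cfg_down x.
  by apply: (periodic_circle _ _ _ n_def); apply: cfg_down_per.
have modE (G : nat -> bool) x : (forall k x, G (x + k * n) = G x) -> G (x %% n) = G x.
  by move=> Gn; rewrite {2}(divn_eq x n) addnC Gn.
have FE x : F (vtx x) = cfg_up x + cfg_down x by rewrite /F /= !modE.
have coverP x : cfg_up x || cfg_down x -> vtx x \in cover c.
  rewrite /cfg_up /cfg_down orbACA orbb => h.
  suff [e [ec xe]] : exists e, e \in c /\ vtx x \in e by apply/bigcupP; exists e.
  case/or3P: h => [xc|/c_opensP[y /andP[_ xy]]|cl].
  - by exists (chord x x); rewrite set21.
  - by exists (chord x y); rewrite set21.
  have o_gt0 : 0 < o by case: o n_def n_gt0 => // ->.
have: closes m cfg_link (x + o.-1 * m).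
  by rewrite (periodic_mul _ _ _ (closes_per m cfg_link cfg_link_per)).
rewrite /= => /c_closesP[b [/andP[_ bx] _]].
exists (chord b (x + o.-1 * m + m)); split=> //.
have -> : x + o.-1 * m + m = x + n by rewrite n_def -addnA -mulSnr prednK.
by rewrite -(vtxD _ n_gt0 x) set22.
have -> : \sum_(i < n) (cfg_up i + cfg_down i) = \sum_(i in cover c) F i.
  rewrite [LHS](bigID (mem (cover c))) /= [X in _ + X]big1 ?addn0 // => i.
  rewrite -(vtx_ord _ n_gt0 i) => ni; have := contra (coverP i) ni.
  by rewrite negb_or !modE // => /andP[/negPf-> /negPf->].
rewrite (big_trivIset _ c_triv) /= (eq_bigr (fun=> 2)) ?sum_nat_const // => e ec.
case: (block_cases _ ec) => [[x ex]|[x [y [xy exy]]]].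
  move: ec; rewrite ex => xc; rewrite /chord setUid big_set1 FE /cfg_up /cfg_down xc //.
have axy : short_arc x y by case/andP: xy.
have ne : vtx x != vtx y by apply/eqP; apply: (short_arc_neq _ n_gt0 _ _ n_def).
rewrite exy /chord big_setU1 ?inE // big_set1 !FE /cfg_up /cfg_down.
have -> : (chord x x \in c) = false by apply/negP => xc; apply: (loop_cfg_link x x y) => //; left.
have -> : (chord y y \in c) = false by apply/negP => xc; apply: (loop_cfg_link y x y) => //; right.
have -> : opens m cfg_link x by apply/c_opensP; exists y.
have -> : closes m cfg_link x = false.
  by apply/negP => cl; apply: (open_close_false x) => //; apply/c_opensP; exists y.
case: (eqVneq y (x + m)) => [ey|ney].
  rewrite ey opens_per ?closes_per //; try exact: cfg_link_per.
  have -> : opens m cfg_link x by apply/c_opensP; exists y.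
  have -> // : closes m cfg_link x = false.
  by apply/negP => cl; apply: (open_close_false x) => //; apply/c_opensP; exists y.
have clo := c_closes _ _ xy ney; rewrite clo.
by have -> : opens m cfg_link y = false by apply/negP => op; apply: (open_close_false y).
Qed.
End Config.

(** * From a word to an invariant configuration *)

Section Word.
Local Open Scope nat_scope.
Variables (n : nat) (n_gt0 : 0 < n) (m o : nat).
Hypothesis n_def : n = o * m.
Local Notation vtx := (vtx n n_gt0).
Local Notation chord := (chord n n_gt0).
Local Notation short_arc := (short_arc n m o).
Variables (up down : nat -> bool).
Local Notation word_link := (word_link m up down).
Local Notation height := (height up down).
Local Notation arch := (arch up down).

Hypothesis up_per : forall x, up (x + m) = up x.
Hypothesis down_per : forall x, down (x + m) = down x.
Hypothesis slope01 : (0 <= height m <= 1)%R.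
Hypothesis slope_half : height m = 1%R -> o = 2.
Hypothesis ballot_word : o = 1 -> forall x, x < m -> (0 <= height x)%R.

Let m_gt0 : 0 < m. Proof. exact: period_gt0 n_def. Qed.
Let m_le : m <= n. Proof. exact: period_le n_def. Qed.
Let wl_lt x y : word_link x y -> x < y <= x + m. Proof. exact: word_link_lt. Qed.
Let wl_per x y : word_link (x + m) (y + m) = word_link x y. Proof. exact: word_link_per. Qed.
Let wl_perD := word_link_perD _ n_gt0 _ _ n_def _ _ up_per down_per.
Let hper x : height (x + m) = (height x + height m)%R. Proof. exact: height_per. Qed.
Let c := build n n_gt0 m up down.
Let cP e := buildP _ n_gt0 _ _ n_def _ _ up_per down_per slope01 e.
Let wl_move := word_link_move _ n_gt0 _ _ n_def _ _ up_per down_per slope01.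

(** If o = 1, the path starts each block at height 0 and stays nonnegative, so it
    cannot be above its height at x when it enters the next block. *)
Lemma word_link_same_block x y : o = 1 -> word_link x y -> x %/ n = y %/ n.
Proof.
move=> o1 xy; have nm := period_eq _ _ _ n_def o1.
have s0 : height m = 0%R by move: slope_half; rewrite o1 => h; lia.
have h0 k : height (k * m) = 0%R.
  elim: k => [|k IHk]; first by rewrite mul0n /height big_ord0.
  by rewrite mulSnr hper IHk s0.
have hx : (0 <= height x)%R.
  rewrite (divn_eq x m); elim: (x %/ m) => [|k IHk].
    by rewrite mul0n add0n; apply: ballot_word => //; rewrite ltn_mod.
  by rewrite mulSnr addnAC hper s0 addr0.
have lt_xy := wl_lt _ _ xy.
have : x %/ n <= y %/ n by apply: leq_div2r; lia.
rewrite leq_eqVlt => /orP[/eqP //|lt].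
have le_y := leq_trunc_div y n; have lt_x : x < y %/ n * n by rewrite -ltn_divLR.
have: (height x < height (y %/ n * n))%R; last by rewrite {2}nm h0; lia.
by case/orP: xy => [/archP[_ h _]|/andP[/climbsP h /eqP ?]]; apply: h; lia.
Qed.

Lemma word_link_adm x y : word_link x y -> short_arc x y.
Proof.
move=> xy; have /andP[lt_xy le_y] := wl_lt _ _ xy; rewrite /short_arc lt_xy /=.
by case: eqP => // o1; apply/eqP; apply: word_link_same_block.
Qed.

Lemma diameter_double x : word_link x (x + m) -> n = m + m.
Proof.
move=> xx; have: (height x < height (x + m))%R.
  case/orP: xx => [/(arch_lt _ _ _ m_gt0 up_per down_per slope01)|]; first by rewrite ltnn.
  by case/andP=> /climbsP h _; apply: h; lia.
rewrite hper => h.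
have o2 : o = 2 by apply: slope_half; lia.
by rewrite n_def o2; lia.
Qed.

Lemma build_card e : e \in c -> (#|e| == 1) || (#|e| == 2).
Proof.
have ed_card x y : (#|chord x y| == 1) || (#|chord x y| == 2).
  by rewrite /chord cards2; case: (vtx x != vtx y).
by case/cP=> [[x [_ ->]]|[x [y [_ ->]]]].
Qed.

Lemma build_step x y : chord x y \in c -> chord (x + m) (y + m) \in c.
Proof.
have shift a b a' b' : chord a b = chord a' b' -> chord (a + m) (b + m) = chord (a' + m) (b' + m).
  move/chord_eq => [[/vtxDl ea /vtxDl eb]|[/vtxDl ea /vtxDl eb]]; first exact: chord_vtx.
  by rewrite [RHS]chordC; apply: chord_vtx.
case/cP=> [[a [aba /shift e]]|[a [b [ab /shift e]]]]; apply/cP; rewrite e.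
  by left; exists (a + m); rewrite up_per down_per.
by right; exists (a + m), (b + m); rewrite wl_per.
Qed.

Lemma build_per x y : (chord (x + m) (y + m) \in c) = (chord x y \in c).
Proof.
apply/idP/idP => [xy|]; last exact: build_step.
have iter_step k : chord (x + m + k * m) (y + m + k * m) \in c.
  elim: k => [|k IHk]; first by rewrite !addn0.
  by rewrite mulSnr !addnA build_step.
have o_gt0 : 0 < o by case: o n_def n_gt0 => // ->.
have := iter_step o.-1; rewrite -!addnA -mulSn prednK // -n_def.
by rewrite (chord_vtx _ _ _ x _ y) ?vtxD.
Qed.

Lemma build_loop x : (chord x x \in c) = up x && down x.
Proof.
apply/idP/idP => [/cP[[a [aba /chord_eq e]]|[a [b [ab /chord_eq e]]]]|abx].
- have {}e : vtx x = vtx a by case: e => -[].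
  have modE (F : nat -> bool) : (forall x, F (x + m) = F x) -> F x = F a.
    move=> /(periodic_circle _ _ _ n_def) Fn; case: (leqP a x) => [le_ax|/ltnW le_xa].
      by have [k ->] := vtx_le _ _ _ _ (esym e) le_ax.
    by have [k ->] := vtx_le _ _ _ _ e le_xa; rewrite Fn.
  by rewrite !modE.
- by case: (short_arc_neq _ n_gt0 _ _ n_def _ _ (word_link_adm _ _ ab)); case: e => -[-> ->].
- by apply/cP; left; exists x.
Qed.

Lemma build_link a b : chord a b \in c -> a < b < a + n -> word_link a b \/ word_link b (a + n).
Proof.
move=> ab lt_ab; case/cP: ab => [[x [_ /chord_eq e]]|[x [y [xy /chord_eq e]]]].
  have /vtx_gap : vtx a = vtx b by case: e => -[-> ->].
  by move=> gap; have := gap; lia.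
have lt_xy := wl_lt _ _ xy.
case: e => -[ea eb].
  left; have [q [aq eq eqn]] := wl_move _ _ _ xy ea; rewrite -eb in eq.
  case: (ltngtP q b) => [lt|lt|<-] //.
    by have := vtx_gap _ _ _ _ eq lt; lia.
  by have := vtx_gap _ _ _ _ (esym eq) lt; lia.
right; have [q [bq eq eqn]] := wl_move _ _ _ xy eb.
rewrite -ea -(vtxD _ _ a) in eq.
case: (ltngtP q (a + n)) => [lt|lt|<-] //.
  by have := vtx_gap _ _ _ _ eq lt; lia.
by have := vtx_gap _ _ _ _ (esym eq) lt; lia.
Qed.

(** Each of the two chords lifts to a link in one of two ways; in all four cases suitable
    translates of the links would cross on the line. *)
Lemma build_nc : nc_set n c.
Proof.
move=> e f ec fc; apply/negP => /(crossingE _ n_gt0) [a [b [a' [b' [h1 h2 h3 e_eq f_eq]]]]].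
move: ec fc; rewrite e_eq f_eq => /build_link hab /build_link ha'b'.
have := ltn_ord a; have := ltn_ord b; have := ltn_ord a'; have := ltn_ord b' => l1 l2 l3 l4.
have pern x y : word_link (x + n) (y + n) = word_link x y by rewrite -[n]mul1n wl_perD.
have nc := word_link_nc _ _ _ m_gt0 up_per down_per slope01.
case: hab => [|ab|ab]; first by lia.
all: case: ha'b' => [|a'b'|a'b']; first by lia.
- exact: nc _ _ _ _ ab a'b' h1 h2 h3.
- rewrite -pern in ab; apply: (nc _ _ _ _ a'b' ab); lia.
- apply: (nc _ _ _ _ a'b' ab); lia.
- apply: (nc _ _ _ _ ab a'b'); lia.
Qed.

(** The kind of step at p tells which kind of block contains p, and then p determines
    this block, by uniqueness of the start or of the end of a link. *)
Lemma build_at e p : e \in c -> vtx p \in e ->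
  [\/ up p && down p /\ e = chord p p,
      exists q, word_link p q /\ e = chord p q
    | exists q, arch q (p + n) /\ e = chord q p].
Proof.
case/cP=> [[x [abx ->]]|[x [y [xy ->]]]].
  rewrite /chord setUid inE => /eqP ep; apply: Or31; split; last by rewrite /chord setUid ep.
  by rewrite -build_loop (chord_vtx _ _ _ x _ x) // build_loop.
case/mem_chord=> ep.
  have [q [pq eq _]] := wl_move _ _ _ xy ep.
  by apply: Or32; exists q; split=> //; apply: chord_vtx.
case/orP: (xy) => [axy|/andP[_ /eqP y_eq]]; last first.
  (* a diameter is seen in the same way from both its ends *)
  have nmm : n = m + m by apply: (diameter_double x); rewrite -y_eq.
  have yy : word_link y (y + m) by rewrite y_eq wl_per -y_eq.
  have [q [pq eq _]] := wl_move _ _ _ yy ep.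
  apply: Or32; exists q; split=> //; rewrite chordC; apply: chord_vtx => //.
  by rewrite eq y_eq -addnA -nmm vtxD.
apply: Or33; have lt_xy := wl_lt _ _ xy.
have arch_of a b : word_link a b -> b != a + m -> arch a b by case/orP=> // /andP[_ ->].
have y_lt := arch_lt _ _ _ m_gt0 up_per down_per slope01 _ _ axy.
have epn : vtx (p + n) = vtx y by rewrite vtxD.
case: (leqP y (p + n)) => [le|/ltnW le].
  have [k k_eq] := vtx_le _ _ _ _ (esym epn) le.
  exists (x + k * n); split; last by apply: chord_vtx; rewrite ?vtxDn.
  by apply: arch_of; [rewrite k_eq wl_perD | lia].
have [k k_eq] := vtx_le _ _ _ _ epn le.
have x_eq : x - k * n + k * n = x by lia.
exists (x - k * n); split.
  by apply: arch_of; [rewrite -(wl_perD k) x_eq -k_eq | lia].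
by apply: chord_vtx => //; rewrite -[in LHS]x_eq vtxDn.
Qed.

Lemma build_triv : trivIset c.
Proof.
apply/trivIsetP => e f ec fc; apply: contraR => /pred0Pn[p /andP[/= pe pf]].
rewrite -(vtx_ord _ n_gt0 p) in pe pf.
have onp q : word_link p q -> up p && ~~ down p by apply: word_link_open.
have cl q : arch q (p + n) -> ~~ up p && down p.
  move=> /arch_close[]; have := periodic_circle _ _ _ n_def _ _ up_per 1 p.
  by have := periodic_circle _ _ _ n_def _ _ down_per 1 p; rewrite mul1n => -> -> -> ->.
case: (build_at _ _ ec pe) => [[h1 ->]|[q1 [h1 ->]]|[q1 [h1 ->]]];
case: (build_at _ _ fc pf) => [[h2 ->]|[q2 [h2 ->]]|[q2 [h2 ->]]] //.
- by move: h1 (onp _ h2) => /andP[_ ->]; rewrite andbF.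
- by move: h1 (cl _ h2) => /andP[->].
- by move: h2 (onp _ h1) => /andP[_ ->]; rewrite andbF.
- by rewrite (word_link_fun _ _ _ m_gt0 up_per down_per slope01 _ _ _ h1 h2).
- by move: (onp _ h1) (cl _ h2) => /andP[->].
- by move: h2 (cl _ h1) => /andP[->].
- by move: (onp _ h2) (cl _ h1) => /andP[->].
- by rewrite (arch_inj _ _ _ _ _ h1 h2).
Qed.

Lemma build_cfg_link x y : cfg_link n n_gt0 m o c x y = word_link x y.
Proof.
apply/andP/idP => [[axy xy]|xy]; last first.
  by split; [apply: word_link_adm | apply/cP; right; exists x, y].
have lt_xy := short_arc_ltn _ n_gt0 _ _ n_def _ _ axy.
case: (build_link _ _ xy lt_xy) => // yx.
have /andP[lt ayx] := word_link_adm _ _ yx; case/andP: axy => _.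
move: ayx; case: (eqVneq o 1) => [_ /eqP->|o1 le1 le2].
  by rewrite divnDr // divnn n_gt0 => /eqP; lia.
have mm := period_double _ n_gt0 _ _ n_def o1.
have y_eq : y = x + m by lia.
by rewrite -wl_per -y_eq (_ : y + m = x + n) //; lia.
Qed.

Lemma build_opens x : opens m (cfg_link n n_gt0 m o c) x = up x && ~~ down x.
Proof.
have lt a b : cfg_link n n_gt0 m o c a b -> a < b <= a + m by rewrite build_cfg_link; apply: wl_lt.
apply/(opensP _ _ lt)/idP => [[y]|/andP[ax bx]].
  by rewrite build_cfg_link; apply: word_link_open.
have [y xy] := word_link_ex _ _ _ m_gt0 slope01 _ ax bx.
by exists y; rewrite build_cfg_link.
Qed.

Lemma build_closes x : closes m (cfg_link n n_gt0 m o c) x = ~~ up x && down x.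
Proof.
have lt a b : cfg_link n n_gt0 m o c a b -> a < b <= a + m by rewrite build_cfg_link; apply: wl_lt.
apply/(closesP _ _ lt)/idP => [[a []]|/andP[ax bx]].
  rewrite build_cfg_link => /orP[/arch_close[]|/andP[_ /eqP]]; last by lia.
  by rewrite up_per down_per => -> ->.
have [|||a ay] := arch_ex _ _ _ m_gt0 up_per down_per slope01 (x + m).
- by rewrite down_per.
- by rewrite up_per.
- exact: leq_addl.
exists a; rewrite build_cfg_link /word_link ay; split=> //.
by have := arch_lt _ _ _ m_gt0 up_per down_per slope01 _ _ ay; lia.
Qed.

Lemma build_up x : cfg_up n n_gt0 m o c x = up x.
Proof. by rewrite /cfg_up build_loop build_opens; case: (up x); case: (down x). Qed.

Lemma build_down x : cfg_down n n_gt0 m o c x = down x.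
Proof. by rewrite /cfg_down build_loop build_closes; case: (up x); case: (down x). Qed.
End Word.

(** * The ballot count *)

Section Ballot.
Local Open Scope nat_scope.

Definition has_pos n (A : {set 'I_n}) (t : nat) : bool :=
  [exists i : 'I_n, (i == t :> nat) && (i \in A)].

Definition prefix_count n (A : {set 'I_n}) (x : nat) : nat := \sum_(t < x) has_pos n A t.

Lemma has_pos_ord n A (i : 'I_n) : has_pos n A i = (i \in A).
Proof.
apply/existsP/idP => [[j /andP[/eqP/val_inj-> //]]|iA].
by exists i; rewrite eqxx.
Qed.

Lemma prefix_count_card n A : prefix_count n A n = #|A|.
Proof.
rewrite /prefix_count -sum1_card [RHS]big_mkcond; apply: eq_bigr => i _.
by rewrite has_pos_ord; case: (i \in A).
Qed.

(** Subsets of {0, ..., n} are subsets of {0, ..., n - 1} plus the choice for n. *)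
Definition extend n (b : bool) (A : {set 'I_n}) : {set 'I_n.+1} :=
  [set i | if unlift ord_max i is Some j then j \in A else b].

Lemma sum_extend n (F : {set 'I_n.+1} -> nat) :
  \sum_A F A = \sum_(A : {set 'I_n}) (F (extend n false A) + F (extend n true A)).
Proof.
rewrite (reindex (fun p : {set 'I_n} * bool => extend n p.2 p.1)) /=.
  rewrite -(pair_bigA _ (fun A b => F (extend n b A))) /=; apply: eq_bigr => A _.
  by rewrite big_bool addnC.
pose restrict (A : {set 'I_n.+1}) := ([set i : 'I_n | lift ord_max i \in A], ord_max \in A).
exists restrict => [[A b] _|A _].
  congr (_, _); last by rewrite inE unlift_none.
  by apply/setP => i; rewrite !inE liftK.
by apply/setP => i; rewrite inE; case: unliftP => [j|] ->; rewrite ?inE.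
Qed.

Lemma has_pos_extend n b A t : has_pos n.+1 (extend n b A) t =
  if t == n then b else has_pos n A t.
Proof.
case: (ltngtP t n) => [lt_tn|lt_nt|->].
- have -> : t = lift ord_max (Ordinal lt_tn) by rewrite lift_max.
  by rewrite has_pos_ord inE liftK lift_max -[t]/(val (Ordinal lt_tn)) has_pos_ord.
- transitivity false; last apply/esym; apply/existsP => -[i /andP[/eqP e _]].
    by have := ltn_ord i; lia.
  by have := ltn_ord i; lia.
- by rewrite -[X in has_pos _ _ X]/(val (@ord_max n)) has_pos_ord inE unlift_none.
Qed.

Lemma prefix_count_extend n b A x : x <= n ->
  prefix_count n.+1 (extend n b A) x = prefix_count n A x.
Proof.
move=> le_xn; apply: eq_bigr => t _; rewrite has_pos_extend.
by have := ltn_ord t; case: eqP => // ->; lia.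
Qed.

Lemma card_extend n b A : #|extend n b A| = #|A| + b.
Proof.
rewrite -prefix_count_card /prefix_count big_ord_recr /= -/(prefix_count _ _ n).
by rewrite prefix_count_extend // prefix_count_card has_pos_extend eqxx.
Qed.

Definition ballot n (A B : {set 'I_n}) : bool :=
  all (fun x => prefix_count n B x <= prefix_count n A x) (iota 0 n.+1).

Lemma ballot_extend n s t (A B : {set 'I_n}) :
  ballot n.+1 (extend n s A) (extend n t B) = ballot n A B && (#|B| + t <= #|A| + s).
Proof.
rewrite /ballot -[n.+2]addn1 iotaD all_cat all_seq1 add0n -!card_extend !prefix_count_card.
congr (_ && _); apply: eq_in_all => x; rewrite mem_iota => /andP[_ lt_x].
by rewrite !prefix_count_extend.
Qed.

Definition nballot n a b : nat :=
  \sum_(A : {set 'I_n}) \sum_(B : {set 'I_n}) [&& #|A| == a, #|B| == b & ballot n A B].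

Lemma nballot_lt n a b : a < b -> nballot n a b = 0.
Proof.
move=> lt_ab; rewrite /nballot big1 // => A _; rewrite big1 // => B _.
apply/eqP; rewrite eqb0; apply/negP => /and3P[/eqP Aa /eqP Bb /allP/(_ n)].
by rewrite mem_iota leqnn !prefix_count_card => /(_ isT); lia.
Qed.

Lemma nballotS n a b : b <= a -> nballot n.+1 a b =
  nballot n a b + (0 < a) * nballot n a.-1 b + (0 < b) * nballot n a b.-1
   + (0 < a) * (0 < b) * nballot n a.-1 b.-1.
Proof.
move=> le_ba; rewrite /nballot sum_extend.
under eq_bigr => A _ do rewrite !sum_extend -big_split /=.
rewrite !big_distrr /= -!big_split /=; apply: eq_bigr => A _.
rewrite !big_distrr /= -!big_split /=; apply: eq_bigr => B _.
rewrite !ballot_extend !card_extend.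
have drop s t : [&& #|A| + s == a, #|B| + t == b, ballot n A B & #|B| + t <= #|A| + s]
    = [&& #|A| + s == a, #|B| + t == b & ballot n A B].
  by case: eqP => //= ->; case: eqP => //= ->; rewrite le_ba andbT.
rewrite !drop /= !addn0 !addn1; case: (ballot n A B); last by rewrite !andbF !muln0.
rewrite !andbT; move: #|A| #|B| => u v {drop}.
case: a b {le_ba} => [|a] [|b]; rewrite ?eqSS ?andbF ?mul0n ?muln0 ?mul1n ?addn0 //=.
by rewrite addnA [X in X + _ = _]addnAC.
Qed.

(** The reflection formula C(n,a) C(n,b) - C(n,a+1) C(n,b-1), by induction on n; the
    recurrence [nballotS] leaves the range b <= a only for a = b, at the term
    [nballot n a.-1 b], which is 0 and for which the formula also gives 0. *)
Lemma nballotE n a b : b <= a ->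
  nballot n a b + (0 < b) * 'C(n, a.+1) * 'C(n, b.-1) = 'C(n, a) * 'C(n, b).
Proof.
elim: n a b => [|n IHn] a b le_ba.
  have set0E (A : {set 'I_0}) : A = set0 by apply/setP => -[].
  rewrite /nballot (big_pred1 set0) => [|A]; last by rewrite /= (set0E A) eqxx.
  rewrite (big_pred1 set0) => [|A]; last by rewrite /= (set0E A) eqxx.
  rewrite cards0 /ballot /= /prefix_count big_ord0 /= !bin0n.
  by case: a b le_ba => [|a] [|b].
rewrite nballotS //.
case: b le_ba => [|b] le_ba.
  rewrite /= !mul0n !muln0 !mul0n !addn0 bin0 muln1; case: a le_ba => [|a] _.
    by have := IHn 0 0 isT; rewrite !bin0 /= !mul0n !addn0.
  have := IHn a.+1 0 isT; have := IHn a 0 isT.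
  by rewrite binS !bin0 /= !mul0n !addn0 !mul1n !muln1 => -> ->.
case: a le_ba => // a le_ba; rewrite /= !mul1n.
have h1 := IHn _ _ le_ba; have h2 := IHn a b le_ba; have h3 := IHn a.+1 b (ltnW le_ba).
have h4 : nballot n a b.+1 + 'C(n, a.+1) * 'C(n, b) = 'C(n, a) * 'C(n, b.+1) \/ a = b.
  case: (eqVneq a b) => [->|ne]; [by right|left].
  by have := IHn a b.+1; rewrite /= mul1n; apply; lia.
have {}h4 : nballot n a b.+1 + 'C(n, a.+1) * 'C(n, b) = 'C(n, a) * 'C(n, b.+1).
  case: h4 => // ->; rewrite nballot_lt // add0n; exact: mulnC.
move: h1 h2 h3 h4; rewrite /= !mul1n !binS.
case: b {IHn le_ba} => [|b]; rewrite /= ?mul0n ?mul1n ?bin0 ?binS.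
  move: (nballot _ _ _) (nballot _ _ _) (nballot _ _ _) (nballot _ _ _).
  by move: 'C(n, a) 'C(n, a.+1) 'C(n, a.+2) 'C(n, 1) => x y z t; lia.
move: (nballot _ _ _) (nballot _ _ _) (nballot _ _ _) (nballot _ _ _).
by move: 'C(n, a) 'C(n, a.+1) 'C(n, a.+2) 'C(n, b) 'C(n, b.+1) 'C(n, b.+2) => x y z t u v; lia.
Qed.
End Ballot.

(** * Configurations fixed by a rotation correspond to good words *)

Lemma rot_permX n (n_gt0 : (0 < n)%N) j x :
  ((rot_perm n ^+ j)%g (vtx n n_gt0 x)) = vtx n n_gt0 (x + j)%N.
Proof.
elim: j => [|j IHj]; first by rewrite expg0 perm1 addn0.
rewrite expgSr permM IHj permE; apply/val_inj.
by rewrite /= addnS -addn1 modnDml addn1.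
Qed.

Lemma order_rot_perm n : (0 < n)%N -> #[rot_perm n]%g = n.
Proof.
move=> n_gt0; apply/eqP; rewrite eqn_dvd; apply/andP; split.
  rewrite order_dvdn; apply/eqP/permP => i; rewrite perm1.
  by rewrite -(vtx_ord n n_gt0 i) rot_permX vtxD.
have /permP/(_ (vtx n n_gt0 0)) := expg_order (rot_perm n).
by rewrite rot_permX perm1 add0n => /(congr1 val) /=; rewrite mod0n /dvdn => ->.
Qed.

Lemma rot_chord n (n_gt0 : (0 < n)%N) j x y :
  ('P^*)%act (chord n n_gt0 x y) (rot_perm n ^+ j)%g = chord n n_gt0 (x + j) (y + j).
Proof.
by rewrite /= /setact imsetU1 imset_set1 /= /aperm !rot_permX.
Qed.

Lemma noncrossing_configP n (c : {set {set 'I_n}}) :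
  reflect [/\ forall e, e \in c -> (#|e| == 1)%N || (#|e| == 2)%N, trivIset c & nc_set n c]
    (noncrossing_config c).
Proof.
apply: (iffP and3P) => -[h1 h2 h3]; split=> //.
- by move=> e ec; have /forall_inP := h1; apply.
- by move=> e f ec fc; have /forall_inP/(_ e ec)/forall_inP := h3; apply.
- exact/forall_inP.
- by apply/forall_inP => e ec; apply/forall_inP => f; apply: h3.
Qed.

Lemma small_block_chord n (n_gt0 : (0 < n)%N) (e : {set 'I_n}) :
  (#|e| == 1)%N || (#|e| == 2)%N -> exists x y, e = chord n n_gt0 x y.
Proof.
case/(small_block n n_gt0) => [[x ->]|[i [j [_ ->]]]]; first by exists x, x.
by exists i, j.
Qed.

(** The image of c has as many blocks as c, so it is enough that it is contained in c. *)
Lemma fix_rotP n (n_gt0 : (0 < n)%N) j (c : {set {set 'I_n}}) :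
  (forall e, e \in c -> (#|e| == 1)%N || (#|e| == 2)%N) ->
  reflect (forall x y, (chord n n_gt0 (x + j) (y + j) \in c) = (chord n n_gt0 x y \in c))
    (c \in afix ('P^*^*)%act [set (rot_perm n ^+ j)%g]).
Proof.
move=> c_card; apply: (iffP afix1P) => [c_fix x y|c_per].
  rewrite -rot_chord -{1}c_fix /= /setact mem_imset //; exact: act_inj.
apply/eqP; rewrite eqEcard; apply/andP; split; last first.
  by rewrite /= /setact card_imset //; apply: act_inj.
apply/subsetP => f /imsetP[e ec ->].
case: (small_block_chord n n_gt0 e (c_card _ ec)) => x [y e_eq].
by rewrite e_eq rot_chord c_per -e_eq.
Qed.

(** Non-crossing is preserved as it has the translation invariant form [nc_chord]. *)
Lemma acts_rot n k : (0 < n)%N ->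
  [acts <[rot_perm n]>%g, on NCC n k | ('P^*^*)%act].
Proof.
move=> n_gt0; rewrite cycle_subG inE in_setT inE; apply/subsetP => c.
rewrite !inE => /andP[/noncrossing_configP[c1 c2 c3] c_card].
have inj : injective (fun e => ('P^*)%act e (rot_perm n)) by apply: act_inj.
have imE : ('P^*^*)%act c (rot_perm n) = [set ('P^*)%act e (rot_perm n) | e in c] by [].
rewrite imE card_imset // c_card andbT; apply/noncrossing_configP; split.
- by move=> f /imsetP[e /c1 e1 ->]; rewrite card_imset //; apply: act_inj.
- apply/trivIsetP => f f' /imsetP[e ec ->] /imsetP[e' ec' ->] ne.
  apply/pred0P => p /=; apply/negP => /andP[/imsetP[q qe ->] /imsetP[q' q'e]].
  move/(act_inj 'P) => e_q; rewrite -e_q in q'e.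
  have /trivIsetP/(_ e e' ec ec') := c2.
  have -> : e != e' by apply: contraNneq ne => ->.
  by move=> /(_ isT)/pred0P/(_ q); rewrite /= qe q'e.
move=> f f' fc f'c; apply/negP => /(crossingE n n_gt0)[a [b [a' [b' [h1 h2 h3 f_eq f'_eq]]]]].
have back x y : chord n n_gt0 x y \in [set ('P^*)%act e (rot_perm n) | e in c] ->
    chord n n_gt0 (x + n.-1) (y + n.-1) \in c.
  have e : ('P^*)%act (chord n n_gt0 (x + n.-1) (y + n.-1)) (rot_perm n) = chord n n_gt0 x y.
    rewrite -[rot_perm n]expg1 rot_chord -!addnA addn1 prednK //.
    by apply: chord_vtx; rewrite vtxD.
  by rewrite -e (mem_imset _ _ inj).
move: fc f'c; rewrite f_eq f'_eq => /back ab /back a'b'.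
by apply: (nc_chord n n_gt0 _ _ _ _ _ c3 ab a'b'); have := ltn_ord b'; lia.
Qed.

Section Words.
Local Open Scope nat_scope.
Variables (n : nat) (n_gt0 : 0 < n) (m o : nat).
Hypothesis n_def : n = o * m.

Let m_gt0 : 0 < m. Proof. exact: period_gt0 n_def. Qed.
(** The indicator function of A, extended periodically to the line. *)
Definition periodize (A : {set 'I_m}) (x : nat) : bool := vtx m m_gt0 x \in A.

(** The second condition allows one more step up than down exactly when there can be a
    diameter. *)
Definition good_word (w : {set 'I_m} * {set 'I_m}) : bool :=
  [&& #|w.2| <= #|w.1|, #|w.1| <= #|w.2| + (o == 2) & (o == 1) ==> ballot m w.1 w.2].

Lemma periodize_per A x : periodize A (x + m) = periodize A x.
Proof. by rewrite /periodize vtxD. Qed.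

Lemma periodize_set (F : nat -> bool) : (forall x, F (x + m) = F x) ->
  forall x, periodize [set i : 'I_m | F i] x = F x.
Proof.
move=> F_per x; rewrite /periodize inE /=.
have := periodic_mul _ _ _ F_per (x %/ m) (x %% m).
by rewrite addnC -divn_eq.
Qed.

Lemma prefix_count_periodize A x : x <= m -> prefix_count m A x = \sum_(t < x) periodize A t.
Proof.
move=> le_xm; apply: eq_bigr => t _; congr (nat_of_bool _).
have lt_tm : t < m by apply: leq_trans le_xm.
by rewrite /periodize -[X in vtx m _ X]/(nat_of_ord (Ordinal lt_tm)) vtx_ord -has_pos_ord.
Qed.

Lemma height_periodize A B x : x <= m ->
  height (periodize A) (periodize B) x = ((prefix_count m A x)%:Z - (prefix_count m B x)%:Z)%R.
Proof.
move=> le_xm; rewrite !prefix_count_periodize // /height; elim: (x) => [|k IHk].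
  by rewrite !big_ord0.
by rewrite !big_ord_recr /= IHk !PoszD; ring.
Qed.

Lemma sum_period (F : nat -> nat) : (forall x, F (x + m) = F x) ->
  \sum_(i < n) F i = o * \sum_(i < m) F i.
Proof.
move=> F_per; rewrite n_def; elim: (o) => [|k IHk]; first by rewrite big_ord0.
rewrite mulSnr big_split_ord /= IHk mulSnr; congr (_ + _).
by apply: eq_bigr => i _; rewrite addnC periodic_mul.
Qed.

Definition config_word (c : {set {set 'I_n}}) : {set 'I_m} * {set 'I_m} :=
  ([set i : 'I_m | cfg_up n n_gt0 m o c i], [set i : 'I_m | cfg_down n n_gt0 m o c i]).

Definition word_config (w : {set 'I_m} * {set 'I_m}) : {set {set 'I_n}} :=
  build n n_gt0 m (periodize w.1) (periodize w.2).

Definition fixed_configs : {set {set {set 'I_n}}} :=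
  [set c in afix ('P^*^*)%act [set (rot_perm n ^+ m)%g] | noncrossing_config c].

Lemma build_ext (up down al' be' : nat -> bool) : up =1 al' -> down =1 be' ->
  build n n_gt0 m up down = build n n_gt0 m al' be'.
Proof.
move=> eal ebe; have eh : height up down =1 height al' be'.
  by move=> x; apply: eq_bigr => t _; rewrite eal ebe.
have ec x y : climbs up down x y = climbs al' be' x y.
  by apply: eq_forallb => z; rewrite !eh.
apply/setP => e; rewrite !inE; apply: eq_existsb => x; rewrite eal ebe.
by congr (_ || _); apply: eq_existsb => y; rewrite /word_link /arch !ec !eh.
Qed.

Section FromConfig.
Variable c : {set {set 'I_n}}.
Hypothesis c_in : c \in fixed_configs.
Let c_nc : noncrossing_config c. Proof. by move: c_in; rewrite inE => /andP[]. Qed.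
Let c1 : forall e, e \in c -> (#|e| == 1) || (#|e| == 2).
Proof. by case/noncrossing_configP: c_nc. Qed.
Let c2 : trivIset c. Proof. by case/noncrossing_configP: c_nc. Qed.
Let c3 : nc_set n c. Proof. by case/noncrossing_configP: c_nc. Qed.
Let c4 x y : (chord n n_gt0 (x + m) (y + m) \in c) = (chord n n_gt0 x y \in c).
Proof. by apply: fix_rotP => //; move: c_in; rewrite inE => /andP[]. Qed.
Local Notation up := (cfg_up n n_gt0 m o c).
Local Notation down := (cfg_down n n_gt0 m o c).

Let up_per x : up (x + m) = up x. Proof. exact: cfg_up_per. Qed.
Let down_per x : down (x + m) = down x. Proof. exact: cfg_down_per. Qed.

Lemma config_wordK : word_config (config_word c) = c.
Proof.
rewrite [RHS](config_build n n_gt0 m o n_def c) //.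
by apply: build_ext; apply: periodize_set.
Qed.

Lemma config_word_card : o * (#|(config_word c).1| + #|(config_word c).2|) = #|c| * 2.
Proof.
rewrite -(config_card n n_gt0 m o n_def c) // (sum_period (fun i => up i + down i)); last first.
  by move=> x; rewrite up_per down_per.
rewrite big_split /= -!sum1_card /=; congr (o * (_ + _)).
  by rewrite [LHS]big_mkcond; apply: eq_bigr => i _; rewrite inE; case: (up i).
by rewrite [LHS]big_mkcond; apply: eq_bigr => i _; rewrite inE; case: (down i).
Qed.

Lemma config_word_height x :
  height (periodize (config_word c).1) (periodize (config_word c).2) x = height up down x.
Proof. by apply: eq_bigr => t _; rewrite !periodize_set. Qed.

Lemma config_word_good : good_word (config_word c).
Proof.
have slope := cfg_slope n n_gt0 m o n_def c c2 c3 c4.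
have half := cfg_slope_half n n_gt0 m o n_def c c2 c4.
have h0 := cfg_ballot n n_gt0 m o n_def c c2 c4.
have hm := config_word_height m; rewrite height_periodize // !prefix_count_card in hm.
rewrite /good_word; apply/and3P; split; first by lia.
  case: (eqVneq o 2) => [_|/eqP o2]; first by lia.
  by have ne1 : height up down m <> 1%R by [move=> /half]; lia.
apply/implyP => /eqP o1; apply/allP => x; rewrite mem_iota => lt_x.
by have := h0 o1 x; rewrite -config_word_height height_periodize //; lia.
Qed.
End FromConfig.

Lemma word_config_fixed w : good_word w ->
  word_config w \in fixed_configs /\ config_word (word_config w) = w.
Proof.
case: w => A B /and3P[/= le_BA le_AB ball].
have hm : height (periodize A) (periodize B) m = (#|A|%:Z - #|B|%:Z)%R.
  by rewrite height_periodize // !prefix_count_card.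
have s01 : (0 <= height (periodize A) (periodize B) m <= 1)%R.
  by rewrite hm; move: le_AB; case: (o == 2) => /=; lia.
have s2 : height (periodize A) (periodize B) m = 1%R -> o = 2.
  by rewrite hm; move: le_AB; case: (eqVneq o 2) => [//|_] /=; lia.
have s1 : o = 1 -> forall x, x < m -> (0 <= height (periodize A) (periodize B) x)%R.
  move=> o1 x lt_xm; rewrite height_periodize ?(ltnW lt_xm) //.
  move: ball; rewrite o1 /= => /allP/(_ x); rewrite mem_iota ltnS (ltnW lt_xm) => /(_ isT); lia.
have Ap := periodize_per A; have Bp := periodize_per B.
have b1 := build_card n n_gt0 m o n_def _ _ Ap Bp s01.
split.
  rewrite inE; apply/andP; split.
    by apply/fix_rotP => //; apply: (build_per n n_gt0 m o n_def).
  apply/noncrossing_configP; split => //.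
    exact: (build_triv n n_gt0 m o n_def).
  exact: (build_nc n n_gt0 m o n_def).
congr (_, _); apply/setP => i; rewrite inE.
  by rewrite (build_up n n_gt0 m o n_def) // /periodize vtx_ord.
by rewrite (build_down n n_gt0 m o n_def) // /periodize vtx_ord.
Qed.

Lemma card_fixed_configs r :
  #|[set c in fixed_configs | #|c| == r]|
    = #|[set w | good_word w & o * (#|w.1| + #|w.2|) == r * 2]|.
Proof.
have inj : {in [set c in fixed_configs | #|c| == r] &, injective config_word}.
  move=> c d; rewrite !inE => /andP[cF _] /andP[dF _] e.
  by rewrite -(config_wordK c) ?inE // e config_wordK ?inE.
rewrite -(card_in_imset inj); apply: eq_card => w; rewrite inE.
apply/imsetP/andP => [[c]|[w_good w_card]].
  rewrite inE => /andP[cF /eqP c_r] ->; rewrite config_word_good // config_word_card //.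
  by rewrite c_r.
have [wF wK] := word_config_fixed _ w_good; exists (word_config w) => //.
by rewrite inE wF /= -(eqn_pmul2r (isT : 0 < 2)) -config_word_card // wK.
Qed.
End Words.

(** * Counting good words, and cyclic sieving *)

Section CountWords.
Local Open Scope nat_scope.
Variables (m o : nat).

Lemma card_pairs a b :
  #|[set w : {set 'I_m} * {set 'I_m} | (#|w.1| == a) && (#|w.2| == b)]| = 'C(m, a) * 'C(m, b).
Proof.
have <- : setX [set A : {set 'I_m} | #|A| == a] [set B : {set 'I_m} | #|B| == b]
   = [set w : {set 'I_m} * {set 'I_m} | (#|w.1| == a) && (#|w.2| == b)].
  by apply/setP => -[A B]; rewrite !inE.
by rewrite cardsX !card_draws card_ord.
Qed.

Lemma card_words_ge3 r : 2 < o ->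
  #|[set w | good_word m o w & o * (#|w.1| + #|w.2|) == r * 2]|
    = if o %| r then 'C(m, r %/ o) ^ 2 else 0.
Proof.
move=> o_gt2; have o_gt0 : 0 < o by lia.
have goodE (w : {set 'I_m} * {set 'I_m}) : good_word m o w && (o * (#|w.1| + #|w.2|) == r * 2)
    = (#|w.1| == #|w.2|) && (o * #|w.2| == r).
  rewrite /good_word; have -> : (o == 2) = false by lia.
  have -> : (o == 1) = false by lia.
  rewrite addn0 /= andbT -eqn_leq eq_sym; case: eqP => //= ->.
  by rewrite addnn -muln2 mulnA eqn_pmul2r.
case: ifP => [/dvdnP[j r_eq]|ndvd].
  rewrite r_eq in goodE *; rewrite mulnK // expnS expn1 -card_pairs; apply: eq_card => w.
  rewrite !inE goodE (mulnC o) eqn_pmul2r //.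
  by case: (eqVneq #|w.2| j) => [->|]; rewrite ?andbT ?andbF.
apply/eqP; rewrite cards_eq0; apply/eqP/setP => w; rewrite !inE goodE.
by apply/negP => /andP[_ /eqP r_eq]; rewrite -r_eq dvdn_mulr in ndvd.
Qed.

Lemma card_words_2 r : o = 2 ->
  #|[set w | good_word m o w & o * (#|w.1| + #|w.2|) == r * 2]|
    = 'C(m, r./2) * 'C(m, uphalf r).
Proof.
move=> ->; rewrite (mulnC 'C(m, r./2)) -card_pairs; apply: eq_card => w.
rewrite !inE /good_word /= andbT.
have := uphalf_half r; have := odd_double_half r.
by case: (odd r) => /=; lia.
Qed.

Lemma card_words_1 r : o = 1 ->
  #|[set w | good_word m o w & o * (#|w.1| + #|w.2|) == r * 2]|
    + (0 < r) * 'C(m, r.-1) * 'C(m, r.+1) = 'C(m, r) ^ 2.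
Proof.
move=> ->; rewrite expnS expn1 -(nballotE m r r) // mulnAC; congr (_ + _).
rewrite /nballot pair_bigA /= -sum1_card big_mkcond /=; apply: eq_bigr => w _.
rewrite inE /good_word /= addn0 mul1n.
have -> : [&& #|w.2| <= #|w.1|, #|w.1| <= #|w.2| & ballot m w.1 w.2] && (#|w.1| + #|w.2| == r * 2)
   = [&& #|w.1| == r, #|w.2| == r & ballot m w.1 w.2].
  by case: (ballot _ _ _); rewrite ?andbT ?andbF //; lia.
by case: [&& _, _ & _].
Qed.
End CountWords.

(** Hence a power of a rotation fixes the same points as the rotation by m = gcd(j, n)
    steps. *)
Lemma cycle_gcd (gT : finGroupType) (x : gT) j :
  <[x ^+ gcdn j #[x]%g]>%g = <[x ^+ j]>%g.
Proof.
apply/esym/eqP; rewrite eqEcard cycle_subG; apply/andP; split.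
  by have /dvdnP[k j_eq] := dvdn_gcdl j #[x]%g; rewrite {1}j_eq mulnC expgM mem_cycle.
by rewrite -!orderE !orderXgcd [gcdn j _]gcdnC gcdnA gcdnn.
Qed.

(** A negative exponent can be replaced by a natural number in the same class modulo n,
    simultaneously in the group and in the field. *)
Lemma exp_nat_of_int (gT : finGroupType) (g : gT) (C : fieldType) (z : C) n (d : int) :
  (0 < n)%N -> (g ^+ n)%g = 1%g -> z ^+ n = 1 ->
  exists j, expgz g d = (g ^+ j)%g /\ z ^ d = z ^+ j.
Proof.
move=> n_gt0 gn zn; case: d => j; first by exists j.
exists (j.+1 * n.-1)%N; split.
  apply/eqP; rewrite /= eq_mulVg1 invgK.
  by rewrite -expgD -mulnS prednK // mulnC expgM gn expg1n.
rewrite NegzE -exprnN; apply: (mulfI (x := z ^+ j.+1)).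
  apply: expf_neq0; apply: contra_eqN zn => /eqP ->.
  by rewrite expr0n gtn_eqF // eq_sym oner_eq0.
rewrite -exprD -mulnS prednK // mulnC exprM zn expr1n mulfV //.
apply: expf_neq0; apply: contra_eqN zn => /eqP ->.
by rewrite expr0n gtn_eqF // eq_sym oner_eq0.
Qed.

Theorem corollary39 (C : numClosedFieldType) (n k : nat)
    (n_ge1 : (1 <= n)%N) (k_le : (k <= n.+1)%N) :
  exists2 f : {poly int}, tofrac f = qNarayana n.+1 k
    & cyclic_sieving C ('P^*^*)%act (NCC n k)
        n <[rot_perm n]>%G (rot_perm n) f.
Proof.
case: k k_le => [|r] r_le.
  exists 0; first by rewrite tofrac0 /qNarayana [qbinom _ (0%:Z - 1)]/= mulr0.
  have NCC0 : NCC n 0 = set0 by apply/setP => c; rewrite !inE andbF.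
  split; rewrite ?NCC0.
  - exact: order_rot_perm.
  - exact: eqxx.
  - by rewrite -NCC0; apply: acts_rot.
  - by move=> i; rewrite coef0.
  - by move=> xi _ d; rewrite set0I cards0 map_poly0 horner0.
exists (qnar n r); first exact: qnar_frac.
split.
- exact: order_rot_perm.
- exact: eqxx.
- exact: acts_rot.
- exact: qnar_ge0.
move=> xi xi_prim d.
have gn : (rot_perm n ^+ n)%g = 1%g by have := expg_order (rot_perm n); rewrite order_rot_perm.
have [j [-> ->]] := exp_nat_of_int _ _ _ _ _ d n_ge1 gn (prim_expr_order xi_prim).
have z_prim := exp_prim_root xi_prim j.
set z := xi ^+ j in z_prim *.
pose m := gcdn j n; pose o := (n %/ m)%N; rewrite -/m -/o in z_prim.
have n_def : n = (o * m)%N by rewrite divnK // dvdn_gcdr.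
have -> : 'Fix_(NCC n r.+1 | 'P^*^*)[(rot_perm n ^+ j)%g]%g
   = [set c in fixed_configs n m | #|c| == r].
  rewrite -afix_cycle -cycle_gcd afix_cycle (order_rot_perm n n_ge1).
  apply/setP => c; rewrite in_setI [RHS]inE [c \in NCC _ _]inE [c \in fixed_configs _ _]inE eqSS.
  by rewrite andbC andbA.
rewrite (card_fixed_configs n n_ge1 m o n_def r).
have : (0 < o)%N by exact: prim_order_gt0 z_prim.
rewrite leq_eqVlt => /orP[/eqP o1|].
  have nm : n = m by rewrite n_def -o1 mul1n.
  rewrite -o1 in z_prim; rewrite qnar_root_1 // nm -(card_words_1 m o) ?natrD ?addrK //.
rewrite leq_eqVlt => /orP[/eqP o2|o_gt2].
  have nm : n = (m * 2)%N by rewrite n_def -o2 mulnC.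
  rewrite -o2 in z_prim; by rewrite card_words_2 // [X in qnar X r]nm qnar_root_2.
have nm : n = (m * o)%N by rewrite n_def mulnC.
by rewrite card_words_ge3 // [X in qnar X r]nm qnar_root_ge3.
Qed.
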